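(* Let $M^{2n}$ be a compact smooth manifold of real dimension $2n$, let $a\in H^2_{\mathrm{DR}}(M,\mathbb R)$, and let $r\geq1$ be an integer. Suppose $$a^r\in V_{\widetilde d}^{2r}(M).$$ For an integer $q$ with $2r\leq q\leq2n$, if $$L_a^r:H^{q-2r}_{\mathrm{DR}}(M,\mathbb R)\longrightarrow H^q_{\mathrm{DR}}(M,\mathbb R),\qquad b\longmapsto a^r\smile b,$$ is surjective, then $$V_{\widetilde d}^q(M)=H^q_{\mathrm{DR}}(M,\mathbb R).$$ If, in addition, $a$ is represented by a symplectic form satisfying hard Lefschetz, then the required surjectivity of $L_a^r$ holds whenever $q\geq n+r$.
   Context: A closed $k$-form $\alpha$ ($k\ge1$) on a compact Riemannian manifold $(M,g)$ with universal cover $p:\widetilde M\to M$ is $\widetilde d$-bounded if $p^*\alpha=d\Gamma$ for some $(k-1)$-form $\Gamma$ on $\widetilde M$ with $\|\Gamma\|_{L^\infty(\widetilde M,p^*g)}<\infty$ (independent of $g$). $V_{\widetilde d}^k(M)\subset H^k_{\mathrm{DR}}(M,\mathbb R)$ is the real subspace of classes having a $\widetilde d$-bounded representative. A symplectic form with class $a$ on $M^{2n}$ satisfies hard Lefschetz if for every $0\le p\le n$ the map $H^p_{\mathrm{DR}}(M,\mathbb R)\to H^{2n-p}_{\mathrm{DR}}(M,\mathbb R)$, $\alpha\mapsto a^{n-p}\smile\alpha$, is an isomorphism. *)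

(* Defs.v *)
From HB Require Import structures.
From mathcomp Require Import all_boot all_order all_algebra all_fingroup.
From mathcomp Require Import generic_quotient ring_quotient.
From mathcomp Require Import all_classical all_reals all_analysis.

Set Implicit Arguments.
Unset Strict Implicit.
Unset Printing Implicit Defensive.

Import Order.TTheory GRing.Theory Num.Theory numFieldNormedType.Exports.

Local Open Scope classical_set_scope.
Local Open Scope ring_scope.

Section SmoothFunctions.
Variable R : realType.

Section Def.
Variables V W : normedModType R.

Fixpoint iter_derive (vs : seq V) (f : V -> W) : V -> W :=
  if vs is v :: vs' then iter_derive vs' ('D_v f) else f.

Definition smooth_on (U : set V) (f : V -> W) : Prop :=
  forall vs x, U x -> differentiable (iter_derive vs f) x.

Lemma near_eq_differentiable (f g : V -> W) x :
  (\forall y \near x, f y = g y) -> differentiable f x -> differentiable g x.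
Proof.
move=> fg df.
have gx : g x = f x by have /nbhs_singleton := fg.
have dfc : continuous ('d f x) by exact: diff_continuous.
have E : g \o shift x = cst (g x) + 'd f x +o_ 0 id.
  apply/eqaddoP => _/posnumP[e].
  have /eqaddoP/(_ e%:num (gt0 e)) := diff_locally df.
  have fg' : \forall y \near (0 : V), f (y + x) = g (y + x).
    move: fg; rewrite (near_shift 0 x) subr0; apply: filterS => y /=.
    by rewrite addrC.
  by move=> H; near=> y; rewrite !fctE /= -(near fg' y) // gx; near: y.
apply/diff_locallyP; have -> : 'd g x = 'd f x :> (V -> W) by exact: diff_unique.
by split.
Unshelve. all: by end_near.
Qed.

Lemma iter_derive_eq (U : set V) (f g : V -> W) : open U ->
  (forall x, U x -> f x = g x) ->
  forall vs x, U x -> iter_derive vs f x = iter_derive vs g x.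
Proof.
move=> oU + vs; elim: vs f g => [|v vs IH] f g fg x Ux //=; first exact: fg.
apply: IH => // y Uy; apply: near_eq_derive.
by apply: (filterS _ (open_nbhs_nbhs (conj oU Uy))).
Qed.

Definition smooth_ord (m : nat) (U : set V) (f : V -> W) : Prop :=
  forall vs, (size vs <= m)%N ->
    forall x, U x -> differentiable (iter_derive vs f) x.

Lemma smooth_onP (U : set V) f : smooth_on U f <-> forall m, smooth_ord m U f.
Proof. by split=> [sf m vs _|sf vs]; [exact: sf|exact: (sf (size vs))]. Qed.

Lemma smooth_ord_eq m (U : set V) (f g : V -> W) : open U ->
  (forall x, U x -> f x = g x) -> smooth_ord m U f -> smooth_ord m U g.
Proof.
move=> oU fg sf vs svs x Ux; apply: near_eq_differentiable (sf vs svs x Ux).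
apply: (filterS _ (open_nbhs_nbhs (conj oU Ux))) => y Uy.
by apply: (iter_derive_eq oU).
Qed.

Lemma smooth_on_eq (U : set V) (f g : V -> W) : open U ->
  (forall x, U x -> f x = g x) -> smooth_on U f -> smooth_on U g.
Proof.
by move=> oU fg /smooth_onP sf; apply/smooth_onP => m; exact: smooth_ord_eq (sf m).
Qed.

Lemma smooth_ordS m (U : set V) (f : V -> W) : smooth_ord m.+1 U f <->
  (forall x, U x -> differentiable f x) /\ forall v, smooth_ord m U ('D_v f).
Proof.
split=> [sf|[sf0 sf] [|v vs]] //; last exact: sf.
by split=> [|v vs svs]; [exact: (sf [::])|exact: (sf (v :: vs))].
Qed.

Lemma smooth_ordW m (U : set V) (f : V -> W) :
  smooth_ord m.+1 U f -> smooth_ord m U f.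
Proof. by move=> sf vs svs; apply: sf; exact: leqW. Qed.

Lemma smooth_ord_differentiable m (U : set V) (f : V -> W) x :
  smooth_ord m U f -> U x -> differentiable f x.
Proof. by move=> sf; exact: (sf [::]). Qed.

Lemma smooth_on_derivable (U : set V) (f : V -> W) v x :
  smooth_on U f -> U x -> derivable f x v.
Proof. by move=> sf Ux; apply: diff_derivable; exact: (sf [::]). Qed.

Lemma smooth_on_cst (U : set V) (c : W) : smooth_on U (cst c).
Proof.
move=> vs; elim: vs c => [|v vs IH] c x Ux /=; first exact: differentiable_cst.
have -> : 'D_v (cst c) = cst (0 : W) :> (V -> W).
  by apply/funext => y; rewrite derive_cst.
exact: IH.
Qed.

Lemma smooth_ordD m (U : set V) (f g : V -> W) : open U ->
  smooth_ord m U f -> smooth_ord m U g -> smooth_ord m U (f + g).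
Proof.
move=> oU; elim: m f g => [|m IH] f g sf sg.
  by case=> //= _ x Ux; apply: differentiableD; [exact: (sf [::])|exact: (sg [::])].
have [df sDf] := (smooth_ordS _ _ _).1 sf.
have [dg sDg] := (smooth_ordS _ _ _).1 sg.
apply/smooth_ordS; split=> [x Ux|v].
  by apply: differentiableD; [exact: df|exact: dg].
apply: (@smooth_ord_eq _ _ ('D_v f + 'D_v g)) => //; last exact: IH.
by move=> y Uy; rewrite deriveD //; apply: diff_derivable; [exact: df|exact: dg].
Qed.

Lemma smooth_onD (U : set V) (f g : V -> W) : open U ->
  smooth_on U f -> smooth_on U g -> smooth_on U (f + g).
Proof.
move=> oU /smooth_onP sf /smooth_onP sg; apply/smooth_onP => m.
exact: smooth_ordD.
Qed.

Lemma smooth_on_sum (U : set V) I (r : seq I) (P : pred I) (F : I -> V -> W) :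
  open U -> (forall i, smooth_on U (F i)) ->
  smooth_on U (\sum_(i <- r | P i) F i).
Proof.
move=> oU sF; elim/big_ind: _ => //; first exact: smooth_on_cst.
by move=> f g; exact: smooth_onD.
Qed.

End Def.

Section Mul.
Variable V : normedModType R.
Implicit Types (U : set V) (f g : V -> R).

Lemma smooth_ordM m U f g : open U ->
  smooth_ord m U f -> smooth_ord m U g -> smooth_ord m U (f * g).
Proof.
move=> oU; elim: m f g => [|m IH] f g sf sg.
  by case=> //= _ x Ux; apply: differentiableM; [exact: (sf [::])|exact: (sg [::])].
have [df sDf] := (smooth_ordS _ _ _).1 sf.
have [dg sDg] := (smooth_ordS _ _ _).1 sg.
apply/smooth_ordS; split=> [x Ux|v].
  by apply: differentiableM; [exact: df|exact: dg].
apply: (@smooth_ord_eq _ _ _ _ (f * 'D_v g + g * 'D_v f)) => //.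
  by move=> y Uy; rewrite deriveM //; apply: diff_derivable; [exact: df|exact: dg].
by apply: smooth_ordD => //; apply: IH => //; exact: smooth_ordW.
Qed.

Lemma smooth_onM U f g : open U ->
  smooth_on U f -> smooth_on U g -> smooth_on U (f * g).
Proof.
move=> oU /smooth_onP sf /smooth_onP sg; apply/smooth_onP => m.
exact: smooth_ordM.
Qed.

Lemma smooth_onZ U f (a : R) : open U -> smooth_on U f -> smooth_on U (a *: f).
Proof.
move=> oU sf; have -> : a *: f = cst a * f by [].
by apply: smooth_onM => //; exact: smooth_on_cst.
Qed.

End Mul.
End SmoothFunctions.

Local Open Scope quotient_scope.

(* Differential forms on open subsets of R^n are written in coordinates: a
   k-covector is a function of the k x n matrix whose rows are its k vector
   arguments. *)

Section Multilinear.
Variables (R : realType) (k n : nat).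

Definition multilinear (f : 'M[R]_(k, n) -> R) : Prop :=
  forall (A B C : 'M[R]_(k, n)) (i : 'I_k) (b c : R),
    row i A = b *: row i B + c *: row i C ->
    row' i B = row' i A -> row' i C = row' i A ->
    f A = b * f B + c * f C.

Definition alternating (f : 'M[R]_(k, n) -> R) : Prop :=
  forall (A : 'M[R]_(k, n)) (i j : 'I_k),
    i != j -> row i A = row j A -> f A = 0.

End Multilinear.

Section Manifolds.
Variable R : realType.

Record chart (n : nat) (M : topologicalType) := Chart {
  dom : set M;
  coord :> M -> 'rV[R]_n;
  icoord : 'rV[R]_n -> M;
  dom_open : open dom;
  img_open : open (coord @` dom);
  coordK : forall m, dom m -> icoord (coord m) = m;
  coord_continuous : {in dom, continuous coord};
  icoord_continuous : {in coord @` dom, continuous icoord} }.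

Definition img n M (c : chart n M) : set 'rV[R]_n := c @` dom c.

(* The expression of a map in two charts, and the set where it makes sense. *)
Definition locrep m n (M N : topologicalType) (f : M -> N)
    (c : chart m M) (c' : chart n N) : 'rV[R]_m -> 'rV[R]_n :=
  fun x => c' (f (icoord c x)).

Definition locdom m n (M N : topologicalType) (f : M -> N) (U : set M)
    (c : chart m M) (c' : chart n N) : set 'rV[R]_m :=
  [set x | [/\ img c x, U (icoord c x) & dom c' (f (icoord c x))]].

Record manifold (n : nat) := Manifold {
  space :> topologicalType;
  space_hausdorff : hausdorff_space space;
  space_second_countable : @second_countable space;
  atlas : Type;
  atlas_chart : atlas -> chart n space;
  chart_at : space -> atlas;
  mem_chart_at : forall m, dom (atlas_chart (chart_at m)) m;
  transition_smooth : forall c c',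
    smooth_on (locdom id setT (atlas_chart c) (atlas_chart c'))
              (locrep id (atlas_chart c) (atlas_chart c')) }.

Coercion atlas_chart : atlas >-> chart.

Definition smooth_map_on m n (M : manifold m) (N : manifold n) (U : set M)
    (f : M -> N) : Prop :=
  {in U, continuous f} /\
  forall (c : atlas M) (c' : atlas N),
    smooth_on (locdom f U c c') (locrep f c c').

Definition smooth_map m n (M : manifold m) (N : manifold n) (f : M -> N) :=
  smooth_map_on setT f.

Definition path_connected_space (T : topologicalType) : Prop :=
  [set: T] !=set0 /\
  forall x y : T, exists f : R -> T,
    [/\ {within `[0, 1], continuous f}, f 0 = x & f 1 = y].

Definition null_homotopic (T : topologicalType) (f : R -> T) : Prop :=
  exists H : R * R -> T,
    [/\ {within `[0, 1] `*` `[0, 1], continuous H},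
        forall t, t \in `[0, 1] -> H (0, t) = f t,
        forall t, t \in `[0, 1] -> H (1, t) = f 0 &
        forall s, s \in `[0, 1] -> H (s, 0) = f 0 /\ H (s, 1) = f 0].

Definition simply_connected (T : topologicalType) : Prop :=
  path_connected_space T /\
  forall f : R -> T, {within `[0, 1], continuous f} -> f 0 = f 1 ->
    null_homotopic f.

(* [s i] is the inverse of [p] from the evenly covered set [U] to the sheet
   [V i]. *)
Definition smooth_covering n (N M : manifold n) (p : N -> M) : Prop :=
  [/\ smooth_map p, set_surj setT setT p &
  forall m : M, exists2 U : set M, open U /\ U m &
    exists (I : Type) (V : I -> set N) (s : I -> M -> N),
      [/\ forall i, open (V i), trivIset setT V,
          p @^-1` U = \bigcup_i V i &
          forall i, [/\ smooth_map_on U (s i),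
            forall y, V i y -> s i (p y) = y &
            forall x, U x -> V i (s i x) /\ p (s i x) = x]]].

Definition universal_cover n (N M : manifold n) (p : N -> M) : Prop :=
  smooth_covering p /\ simply_connected N.

End Manifolds.

Section Forms.
Variables (R : realType) (n : nat).
Implicit Types M N : manifold R n.

(* A family of coordinate expressions, one for each chart; only the values at
   points of the image of the chart are meaningful. *)
Definition rform M (k : nat) := atlas M -> 'rV[R]_n -> 'M[R]_(k, n) -> R.
HB.instance Definition _ M k := GRing.Lmodule.on (rform M k).

Definition rform_eq M k (w e : rform M k) : Prop :=
  forall (c : atlas M) x v, img c x -> w c x v = e c x v.

Definition pullback_at N M (p : N -> M) k (w : rform M k) (c : atlas N)
    (c' : atlas M) (x : 'rV[R]_n) (v : 'M[R]_(k, n)) : R :=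
  w c' (locrep p c c' x) (v *m 'J (locrep p c c') x).

Definition pullback N M (p : N -> M) k (w : rform M k) : rform N k :=
  fun c x => pullback_at p w c (chart_at (p (icoord c x))) x.

Record form_spec M k (w : rform M k) : Prop := FormSpec {
  form_smooth : forall (c : atlas M) v, smooth_on (img c) (fun x => w c x v);
  form_multilinear : forall (c : atlas M) x, img c x -> multilinear (w c x);
  form_alternating : forall (c : atlas M) x, img c x -> alternating (w c x);
  form_compat : forall (c c' : atlas M) x v, locdom id setT c c' x ->
    w c x v = pullback_at id w c c' x v }.

Definition ext_d M k (w : rform M k) : rform M k.+1 := fun c x v =>
  \sum_(i < k.+1) (-1) ^+ i * 'D_(row i v) (fun y => w c y (row' i v)) x.

Definition wedge M p q (a : rform M p) (b : rform M q) : rform M (p + q) :=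
  fun c x v => (p`! * q`!)%:R^-1 *
    \sum_(s : 'S_(p + q)) (-1) ^+ s *
      (a c x (usubmx (row_perm s v)) * b c x (dsubmx (row_perm s v))).

Definition one_form0 M : rform M 0 := fun _ _ _ => 1.

Definition is_form M k : {pred rform M k} := fun w => `[< form_spec w >].

Definition is_closed_form M k : {pred rform M k} :=
  fun w => `[< form_spec w /\ rform_eq (ext_d w) 0 >].

(* There are no forms of degree -1, so the only exact 0-form is 0. *)
Definition exact_form M k : rform M k -> Prop :=
  match k with
  | 0 => fun w => rform_eq w 0
  | k'.+1 => fun w => exists2 g : rform M k', form_spec g & rform_eq w (ext_d g)
  end.

Section FormTheory.
Variables (M : manifold R n).

Lemma rform0E k c x v : (0 : rform M k) c x v = 0. Proof. by []. Qed.

Lemma rformDE k (w e : rform M k) c x v : (w + e) c x v = w c x v + e c x v.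
Proof. by []. Qed.

Lemma rformZE k a (w : rform M k) c x v : (a *: w) c x v = a * w c x v.
Proof. by []. Qed.

Definition rformE := (rform0E, rformDE, rformZE).

Lemma form_derivable k (w : rform M k) (c : atlas M) x v u :
  form_spec w -> img c x -> derivable (fun y => w c y v) x u.
Proof. by move=> fw; apply: smooth_on_derivable; exact: form_smooth. Qed.

Lemma form_spec0 k : form_spec (0 : rform M k).
Proof.
split=> // [c v|c x _ A B C i b d _ _ _].
  exact: (@smooth_on_cst R 'rV[R]_n R _ 0).
by rewrite !rformE !mulr0 addr0.
Qed.

Lemma form_specD k (w e : rform M k) :
  form_spec w -> form_spec e -> form_spec (w + e).
Proof.
move=> fw fe; split.
- move=> c v; apply: smooth_onD; [exact: img_open|exact: form_smooth..].
- move=> c x cx A B C i b d h1 h2 h3; rewrite !rformE.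
  rewrite (form_multilinear fw cx h1 h2 h3) (form_multilinear fe cx h1 h2 h3).
  by rewrite !mulrDr addrACA.
- move=> c x cx A i j ij Aij; rewrite !rformE.
  by rewrite (form_alternating fw cx ij Aij) (form_alternating fe cx ij Aij) addr0.
- move=> c c' x v cc'; rewrite /pullback_at !rformE.
  by rewrite (form_compat fw v cc') (form_compat fe v cc').
Qed.

Lemma form_specZ k (a : R) (w : rform M k) :
  form_spec w -> form_spec (a *: w).
Proof.
move=> fw; split.
- move=> c v.
  apply: (@smooth_onZ R 'rV[R]_n _ (fun x => w c x v)); [exact: img_open|exact: form_smooth].
- move=> c x cx A B C i b d h1 h2 h3; rewrite !rformE.
  by rewrite (form_multilinear fw cx h1 h2 h3) mulrDr !(mulrCA a).
- move=> c x cx A i j ij Aij; rewrite !rformE.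
  by rewrite (form_alternating fw cx ij Aij) mulr0.
- move=> c c' x v cc'; rewrite /pullback_at !rformE.
  by rewrite (form_compat fw v cc').
Qed.

Lemma ext_dD k (w e : rform M k) : form_spec w -> form_spec e ->
  rform_eq (ext_d (w + e)) (ext_d w + ext_d e).
Proof.
move=> fw fe c x v cx; rewrite !rformE /ext_d -big_split /=.
apply: eq_bigr => i _; rewrite -mulrDr; congr (_ * _).
by rewrite -deriveD //; exact: form_derivable.
Qed.

Lemma ext_dZ k a (w : rform M k) : form_spec w ->
  rform_eq (ext_d (a *: w)) (a *: ext_d w).
Proof.
move=> fw c x v cx; rewrite !rformE /ext_d mulr_sumr /=.
apply: eq_bigr => i _; rewrite mulrCA; congr (_ * _).
by rewrite -[RHS]/(a *: _) -deriveZ //; exact: form_derivable.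
Qed.

Lemma ext_d0 k : rform_eq (ext_d (0 : rform M k)) 0.
Proof.
move=> c x v cx; rewrite /ext_d big1 // => i _.
by rewrite (_ : (fun _ => _) = cst 0) ?derive_cst ?mulr0.
Qed.

Lemma is_closed_form_submod k : submod_closed (@is_closed_form M k).
Proof.
split=> [|a w e /asboolP[fw dw] /asboolP[fe de]]; apply/asboolP; split.
- exact: form_spec0.
- exact: ext_d0.
- by apply: form_specD => //; exact: form_specZ.
- move=> c x v cx; rewrite ext_dD //; last exact: form_specZ.
  by rewrite !rformE ext_dZ // !rformE dw // de // mulr0 addr0.
Qed.

HB.instance Definition _ k :=
  GRing.isSubmodClosed.Build R (rform M k) (@is_closed_form M k)
    (@is_closed_form_submod k).

End FormTheory.

Record closed_form M k := ClosedForm {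
  cform :> rform M k;
  cformP : cform \in @is_closed_form M k }.

HB.instance Definition _ M k := [isSub for @cform M k].
HB.instance Definition _ M k := [Choice of closed_form M k by <:].
HB.instance Definition _ M k :=
  [SubChoice_isSubLmodule of closed_form M k by <:].

Definition is_exact M k : {pred closed_form M k} :=
  fun w => `[< exact_form w >].

Lemma rform_eq_add M k (w w' e e' : rform M k) :
  rform_eq w w' -> rform_eq e e' -> rform_eq (w + e) (w' + e').
Proof. by move=> ww' ee' c x v cx; rewrite !rformE ww' // ee'. Qed.

Lemma rform_eq_scale M k a (w w' : rform M k) :
  rform_eq w w' -> rform_eq (a *: w) (a *: w').
Proof. by move=> ww' c x v cx; rewrite !rformE ww'. Qed.

Lemma is_exact_submod M k : submod_closed (@is_exact M k).
Proof.
split=> [|a w e /asboolP + /asboolP]; last first.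
  move=> wx ex; apply/asboolP; case: k w e wx ex => [|k] w e /=.
    move=> w0 e0 c x v cx.
    by rewrite !rformE w0 // e0 // !rformE mulr0 addr0.
  move=> [g fg wg] [h fh eh]; exists (a *: g + h).
    by apply: form_specD => //; exact: form_specZ.
  move=> c x v cx; rewrite ext_dD //; last exact: form_specZ.
  by rewrite !rformE wg // eh // ext_dZ.
apply/asboolP; case: k => [|k] //=; exists 0; first exact: form_spec0.
by move=> c x v cx; rewrite ext_d0.
Qed.

HB.instance Definition _ M k :=
  GRing.isSubmodClosed.Build R (closed_form M k) (@is_exact M k)
    (@is_exact_submod M k).

Definition deRham M k : Type := Quotient.quot (@is_exact M k).
HB.instance Definition _ M k := GRing.Zmodule.on (deRham M k).
HB.instance Definition _ M k := EqQuotient.on (deRham M k).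

Definition class_of M k (w : closed_form M k) : deRham M k := \pi_(deRham M k) w.

Lemma class_ofP M k (w e : closed_form M k) :
  class_of w = class_of e <-> exact_form (w - e : closed_form M k).
Proof.
rewrite /class_of; split=> [/eqP|H].
  by rewrite -Quotient.idealrBE => /asboolP.
by apply/eqP; rewrite -Quotient.idealrBE; apply/asboolP.
Qed.

Lemma class_of_is_zmod_morphism M k : zmod_morphism (@class_of M k).
Proof. by move=> w e; rewrite /class_of raddfB. Qed.

Definition deRham_scale M k (a : R) (x : deRham M k) : deRham M k :=
  class_of (a *: repr x).

Lemma deRham_scale_class M k a (w : closed_form M k) :
  deRham_scale a (class_of w) = class_of (a *: w).
Proof.
rewrite /deRham_scale; apply/class_ofP.
have : class_of (repr (class_of w)) = class_of w by exact: reprK.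
move=> /class_ofP H.
have : (repr (class_of w) - w) \in @is_exact M k by exact/asboolP.
move=> /(rpredZ a); rewrite scalerBr => /asboolP.
exact.
Qed.

Lemma deRham_ind M k (P : deRham M k -> Prop) :
  (forall w, P (class_of w)) -> forall x, P x.
Proof. by move=> H x; rewrite -[x]reprK; exact: H. Qed.
Section DeRhamModule.
Variables (M : manifold R n) (k : nat).
Implicit Types x y : deRham M k.

HB.instance Definition _ :=
  GRing.isZmodMorphism.Build _ _ (@class_of M k) (@class_of_is_zmod_morphism M k).

Lemma deRham_scaleA a b x :
  deRham_scale a (deRham_scale b x) = deRham_scale (a * b) x.
Proof.
by elim/deRham_ind: x => w; rewrite !deRham_scale_class scalerA.
Qed.

Lemma deRham_scale1 : left_id 1 (@deRham_scale M k).
Proof. by elim/deRham_ind => w; rewrite deRham_scale_class scale1r. Qed.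

Lemma deRham_scaleDr : right_distributive (@deRham_scale M k) +%R.
Proof.
move=> a; elim/deRham_ind => w; elim/deRham_ind => e.
by rewrite -raddfD !deRham_scale_class scalerDr raddfD.
Qed.

Lemma deRham_scaleDl x : {morph (@deRham_scale M k)^~ x : a b / a + b}.
Proof.
move=> a b; elim/deRham_ind: x => w.
by rewrite !deRham_scale_class scalerDl raddfD.
Qed.

HB.instance Definition _ := GRing.Zmodule_isLmodule.Build R (deRham M k)
  deRham_scaleA deRham_scale1 deRham_scaleDr deRham_scaleDl.

End DeRhamModule.
End Forms.

Section AltSum.
Variables (R : realType) (n : nat).

Lemma altsum_lift p q (P : 'rV[R]_n -> 'M[R]_(p, n) -> 'M[R]_(q, n) -> R) :
  (forall u b, \sum_(j < p.+1) (-1) ^+ j * P (row j u) (row' j u) b = 0) ->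
  forall v : 'M[R]_(p.+1 + q, n),
  \sum_(t : 'S_(p.+1 + q)) (-1) ^+ t *
    P (row 0 (usubmx (row_perm t v))) (row' 0 (usubmx (row_perm t v)))
      (dsubmx (row_perm t v)) = 0.
Proof.
move=> P0 v.
pose F (t : 'S_(p.+1 + q)) : R := (-1) ^+ t *
    P (row 0 (usubmx (row_perm t v))) (row' 0 (usubmx (row_perm t v)))
      (dsubmx (row_perm t v)).
rewrite -[LHS]/(\sum_t F t).
pose rho (j : 'I_p.+1) : 'S_(p.+1 + q) := lift_perm (@ord0 (p + q)) (lshift q j) 1.
pose G t (j : 'I_p.+1) : R := (-1) ^+ (t : 'S_(p.+1 + q)) * ((-1) ^+ j *
    P (row j (usubmx (row_perm t v))) (row' j (usubmx (row_perm t v)))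
      (dsubmx (row_perm t v))).
have E j : \sum_t F t = \sum_t G t j.
  rewrite (reindex_inj (mulgI (rho j))) /=; apply: eq_bigr => t _.
  rewrite /F /G odd_permM odd_lift_perm odd_perm1 addbF /= signr_addb mulrA.
  rewrite (mulrC ((-1) ^+ t)) signr_odd row_permM; set w := row_perm t v.
  congr (_ * P _ _ _); apply/matrixP => a b; rewrite !mxE; congr (v (t _) _).
  - have -> : lshift q (0 : 'I_p.+1) = (@ord0 (p + q)) by exact: val_inj.
    by rewrite lift_perm_id.
  - have -> : lshift q (lift (0 : 'I_p.+1) a) = lift (@ord0 (p + q)) (lshift q a).
      exact: val_inj.
    by rewrite lift_perm_lift perm1; exact: val_inj.
  - have -> : rshift p.+1 a = lift (@ord0 (p + q)) (rshift p a).
      exact: val_inj.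
    rewrite lift_perm_lift perm1; apply: val_inj => /=.
    have -> : bump j (p + a) = (p + a).+1.
      by rewrite /bump (leq_trans _ (leq_addr a p)) // -ltnS.
    by [].
have : p.+1%:R * (\sum_t F t) = 0.
  transitivity (\sum_(j < p.+1) \sum_t F t).
    by rewrite sumr_const card_ord mulr_natl.
  rewrite (eq_bigr _ (fun j _ => E j)) exchange_big /= big1 // => t _.
  by rewrite -mulr_sumr P0 mulr0.
by move=> /eqP; rewrite mulf_eq0 pnatr_eq0 /= => /eqP.
Qed.

Lemma altsum_rowsub N p q (f : 'I_(p.+1 + q) -> 'I_N)
    (P : 'rV[R]_n -> 'M[R]_(p, n) -> 'M[R]_(q, n) -> R) :
  bijective f ->
  (forall u b, \sum_(j < p.+1) (-1) ^+ j * P (row j u) (row' j u) b = 0) ->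
  forall v : 'M[R]_(N, n),
  \sum_(t : 'S_N) (-1) ^+ t *
    P (row 0 (usubmx (rowsub f (row_perm t v))))
      (row' 0 (usubmx (rowsub f (row_perm t v))))
      (dsubmx (rowsub f (row_perm t v))) = 0.
Proof.
move=> fbij P0.
have eN : N = (p.+1 + q)%N by have := bij_eq_card fbij; rewrite !card_ord.
subst N => v.
have [s sE] : exists s : 'S_(p.+1 + q), f =1 s.
  by exists (perm (bij_inj fbij)) => i; rewrite permE.
have fE w : rowsub f w = row_perm s w.
  by apply/matrixP => i j; rewrite !mxE sE.
transitivity ((-1) ^+ s * (\sum_(t : 'S_(p.+1 + q)) (-1) ^+ t *
    P (row 0 (usubmx (row_perm t v))) (row' 0 (usubmx (row_perm t v)))
      (dsubmx (row_perm t v)))); last by rewrite altsum_lift ?mulr0.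
rewrite [in RHS](reindex_inj (mulgI s)) mulr_sumr /=; apply: eq_bigr => t _.
by rewrite odd_permM signr_addb !mulrA -expr2 sqrr_sign mul1r row_permM fE.
Qed.

End AltSum.

Section Wedge.
Variables (R : realType) (n : nat) (M : manifold R n).

Lemma wedge_smooth p q (a : rform M p) (b : rform M q) (c : atlas M) v :
  form_spec a -> form_spec b -> smooth_on (img c) (fun x => wedge a b c x v).
Proof.
move=> fa fb; have oc : open (img c) by exact: img_open.
pose F (s : 'S_(p + q)) : 'rV[R]_n -> R := (-1) ^+ s *:
  ((fun x => a c x (usubmx (row_perm s v))) *
   (fun x => b c x (dsubmx (row_perm s v)))).
have -> : (fun x => wedge a b c x v) =
    ((p`! * q`!)%:R^-1 : R) *: (\sum_s F s).
  apply/funext => x; rewrite /wedge /F.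
  by rewrite [RHS]/GRing.scale /= fct_sumE.
apply: smooth_onZ => //; apply: smooth_on_sum => // s.
by apply: smooth_onZ => //; apply: smooth_onM => //; exact: form_smooth.
Qed.

Lemma wedge_multilinear p q (a : rform M p) (b : rform M q) (c : atlas M) x :
  form_spec a -> form_spec b -> img c x -> multilinear (wedge a b c x).
Proof.
move=> fa fb cx A B C i l m hi hB hC; rewrite /wedge (mulrCA l) (mulrCA m) -mulrDr.
congr (_ * _); rewrite !mulr_sumr -big_split /=.
apply: eq_bigr => s _; rewrite (mulrCA l) (mulrCA m) -mulrDr; congr (_ * _).
have eqB k : k != i -> row k B = row k A.
  rewrite eq_sym => /unlift_some[j -> _]; apply/rowP => z.
  by move: hB => /matrixP/(_ j z); rewrite !mxE.
have eqC k : k != i -> row k C = row k A.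
  rewrite eq_sym => /unlift_some[j -> _]; apply/rowP => z.
  by move: hC => /matrixP/(_ j z); rewrite !mxE.
have rowE r r' (D : 'M[R]_(r', n)) (f : 'I_r -> 'I_r') k :
    row k (rowsub f D) = row (f k) D.
  by apply/rowP => z; rewrite !mxE.
have uE (D : 'M[R]_(p + q, n)) :
    usubmx (row_perm s D) = rowsub (s \o lshift q) D.
  by apply/matrixP => y z; rewrite !mxE.
have dE (D : 'M[R]_(p + q, n)) :
    dsubmx (row_perm s D) = rowsub (s \o @rshift p q) D.
  by apply/matrixP => y z; rewrite !mxE.
rewrite !uE !dE.
have := splitK ((s^-1)%g i); case: (fintype.split _) => j /= ji.
- have sj : s (lshift q j) = i by rewrite ji permKV.
  have -> : rowsub (s \o @rshift p q) B = rowsub (s \o @rshift p q) A.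
    apply/row_matrixP => k; rewrite !rowE eqB //= -sj.
    by rewrite (inj_eq perm_inj) eq_sym eq_lrshift.
  have -> : rowsub (s \o @rshift p q) C = rowsub (s \o @rshift p q) A.
    apply/row_matrixP => k; rewrite !rowE eqC //= -sj.
    by rewrite (inj_eq perm_inj) eq_sym eq_lrshift.
  rewrite !mulrA -mulrDl; congr (_ * _).
  apply: (form_multilinear fa cx (i := j)).
  + by rewrite !rowE /= sj.
  + apply/row_matrixP => k; rewrite !row'Esub !rowE eqB //= -sj.
    by rewrite (inj_eq perm_inj) (inj_eq (@lshift_inj _ _)) eq_sym neq_lift.
  + apply/row_matrixP => k; rewrite !row'Esub !rowE eqC //= -sj.
    by rewrite (inj_eq perm_inj) (inj_eq (@lshift_inj _ _)) eq_sym neq_lift.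
- have sj : s (rshift p j) = i by rewrite ji permKV.
  have -> : rowsub (s \o lshift q) B = rowsub (s \o lshift q) A.
    apply/row_matrixP => k; rewrite !rowE eqB //= -sj.
    by rewrite (inj_eq perm_inj) eq_lrshift.
  have -> : rowsub (s \o lshift q) C = rowsub (s \o lshift q) A.
    apply/row_matrixP => k; rewrite !rowE eqC //= -sj.
    by rewrite (inj_eq perm_inj) eq_lrshift.
  rewrite (mulrCA l) (mulrCA m) -mulrDr; congr (_ * _).
  apply: (form_multilinear fb cx (i := j)).
  + by rewrite !rowE /= sj.
  + apply/row_matrixP => k; rewrite !row'Esub !rowE eqB //= -sj.
    by rewrite (inj_eq perm_inj) (inj_eq (@rshift_inj _ _)) eq_sym neq_lift.
  + apply/row_matrixP => k; rewrite !row'Esub !rowE eqC //= -sj.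
    by rewrite (inj_eq perm_inj) (inj_eq (@rshift_inj _ _)) eq_sym neq_lift.
Qed.

Lemma wedge_alternating p q (a : rform M p) (b : rform M q) (c : atlas M) x :
  alternating (wedge a b c x).
Proof.
move=> A i j ij Aij; rewrite /wedge; set S := (X in _ * X).
suff -> : S = 0 by rewrite mulr0.
suff : S = - S by move=> /eqP; rewrite -addr_eq0 -mulr2n mulrn_eq0 => /eqP.
rewrite {1}/S (reindex_inj (mulIg (tperm i j))) /= -sumrN.
apply: eq_bigr => s _.
rewrite odd_permM odd_tperm ij addbT signrN mulNr row_permM.
suff -> : row_perm (tperm i j) A = A by [].
apply/row_matrixP => k; rewrite [LHS](_ : _ = row (tperm i j k) A).
  by case: tpermP => // ->.
by apply/rowP => z; rewrite !mxE.
Qed.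

Lemma wedge_compat p q (a : rform M p) (b : rform M q) (c c' : atlas M) x v :
  form_spec a -> form_spec b -> locdom id setT c c' x ->
  wedge a b c x v = pullback_at id (wedge a b) c c' x v.
Proof.
move=> fa fb cc'; rewrite /pullback_at /wedge; congr (_ * _).
apply: eq_bigr => s _; congr (_ * _).
rewrite (form_compat fa _ cc') (form_compat fb _ cc') /pullback_at.
by rewrite mul_usub_mx mul_dsub_mx !row_permE mulmxA.
Qed.

Lemma wedge_form p q (a : rform M p) (b : rform M q) :
  form_spec a -> form_spec b -> form_spec (wedge a b).
Proof.
move=> fa fb; split=> [c v|c x cx|c x _|c c' x v cc'].
- exact: wedge_smooth.
- exact: wedge_multilinear.
- exact: wedge_alternating.
- exact: wedge_compat.
Qed.

Lemma wedge_closed p q (a : rform M p) (b : rform M q) :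
  form_spec a -> form_spec b ->
  rform_eq (ext_d a) 0 -> rform_eq (ext_d b) 0 ->
  rform_eq (ext_d (wedge a b)) 0.
Proof.
move=> fa fb da db c x v cx; rewrite rform0E /ext_d.
pose Pa u A B : R := 'D_u (fun y => a c y A) x * b c x B.
pose Pb u B A : R := 'D_u (fun y => b c y B) x * a c x A.
have PaE u B : \sum_(j < p.+1) (-1) ^+ j * Pa (row j u) (row' j u) B = 0.
  under eq_bigr do rewrite /Pa mulrA.
  by rewrite -mulr_suml -[X in X * _]/(ext_d a c x u) da // mul0r.
have PbE u A : \sum_(j < q.+1) (-1) ^+ j * Pb (row j u) (row' j u) A = 0.
  under eq_bigr do rewrite /Pb mulrA.
  by rewrite -mulr_suml -[X in X * _]/(ext_d b c x u) db // mul0r.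
have DE u w : 'D_u (fun y => wedge a b c y w) x = (p`! * q`!)%:R^-1 *
    \sum_(s : 'S_(p + q)) (-1) ^+ s *
      (Pa u (usubmx (row_perm s w)) (dsubmx (row_perm s w)) +
       Pb u (dsubmx (row_perm s w)) (usubmx (row_perm s w))).
  pose F (s : 'S_(p + q)) : 'rV[R]_n -> R := (-1) ^+ s *:
    ((fun x => a c x (usubmx (row_perm s w))) *
     (fun x => b c x (dsubmx (row_perm s w)))).
  have -> : (fun y => wedge a b c y w) =
      ((p`! * q`!)%:R^-1 : R) *: (\sum_s F s).
    apply/funext => y; rewrite /wedge /F.
    by rewrite [RHS]/GRing.scale /= fct_sumE.
  have dF s : is_derive x u (F s) ((-1) ^+ s *
      (Pa u (usubmx (row_perm s w)) (dsubmx (row_perm s w)) +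
       Pb u (dsubmx (row_perm s w)) (usubmx (row_perm s w)))).
    have daw : derivable (fun y => a c y (usubmx (row_perm s w))) x u.
      exact: form_derivable.
    have dbw : derivable (fun y => b c y (dsubmx (row_perm s w))) x u.
      exact: form_derivable.
    have dab := derivableM daw dbw.
    apply: DeriveDef; first by apply: derivableZ; exact: dab.
    rewrite deriveZ; last exact: dab.
    rewrite (deriveM daw dbw); congr (_ * _).
    by rewrite addrC /Pa /Pb; congr (_ + _); exact: mulrC.
  have [dS ES] : is_derive x u (\sum_s F s) (\sum_(s : 'S_(p + q)) (-1) ^+ s *
      (Pa u (usubmx (row_perm s w)) (dsubmx (row_perm s w)) +
       Pb u (dsubmx (row_perm s w)) (usubmx (row_perm s w)))).
    elim/big_ind2 : _ => // [|f f' g g' df dg]; first exact: is_derive_cst.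
    exact: is_deriveD.
  by rewrite deriveZ // ES.
under eq_bigr do rewrite DE (mulrCA (_ ^+ _)).
rewrite -mulr_sumr; apply/eqP; rewrite mulf_eq0; apply/orP; right; apply/eqP.
pose H (t : 'S_(p + q).+1) : R := (-1) ^+ t *
  (Pa (row ord0 (row_perm t v)) (usubmx (row' ord0 (row_perm t v)))
     (dsubmx (row' ord0 (row_perm t v))) +
   Pb (row ord0 (row_perm t v)) (dsubmx (row' ord0 (row_perm t v)))
     (usubmx (row' ord0 (row_perm t v)))).
transitivity (\sum_t H t).
  rewrite [RHS](reindex (fun z : 'I_(p + q).+1 * 'S_(p + q) =>
    lift_perm ord0 z.1 z.2)) /=; last first.
    apply: onW_bij; apply: inj_card_bij => [[i s] [j t] /= E|].
      have ij : i = j by rewrite -(lift_perm_id ord0 i s) E lift_perm_id.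
      congr (_, _); first exact: ij.
      apply/permP => k; apply: (@lift_inj _ i).
      by rewrite -(lift_perm_lift ord0) E lift_perm_lift ij.
    by rewrite card_prod card_ord !card_Sn factS.
  rewrite -(pair_bigA _ (fun i s => H (lift_perm ord0 i s))) /=.
  apply: eq_bigr => i _; rewrite mulr_sumr; apply: eq_bigr => s _.
  have rowE : row ord0 (row_perm (lift_perm ord0 i s) v) = row i v.
    by apply/rowP => z; rewrite !mxE lift_perm_id.
  have row'E : row' ord0 (row_perm (lift_perm ord0 i s) v) =
      row_perm s (row' i v).
    by apply/matrixP => y z; rewrite !mxE lift_perm_lift.
  rewrite /H rowE row'E odd_lift_perm /= signr_addb signr_odd mulrA.
  by [].
rewrite /H; under eq_bigr do rewrite mulrDr.
rewrite big_split /=; set SA := \sum_i _; set SB := \sum_i _.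
have -> : SA = 0.
  have bid : bijective (id : 'I_(p.+1 + q) -> 'I_(p + q).+1) by exists id.
  rewrite -[RHS](altsum_rowsub bid PaE v); apply: eq_bigr => t _.
  have -> : row 0 (usubmx (rowsub (id : 'I_(p.+1 + q) -> 'I_(p + q).+1)
      (row_perm t v))) = row ord0 (row_perm t v).
    by apply/rowP => z; rewrite !mxE; congr (v (t _) _); exact: val_inj.
  have -> : row' 0 (usubmx (rowsub (id : 'I_(p.+1 + q) -> 'I_(p + q).+1)
      (row_perm t v))) = usubmx (row' ord0 (row_perm t v)).
    by apply/matrixP => y z; rewrite !mxE; congr (v (t _) _); exact: val_inj.
  have -> // : dsubmx (rowsub (id : 'I_(p.+1 + q) -> 'I_(p + q).+1)
      (row_perm t v)) = dsubmx (row' ord0 (row_perm t v)).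
  by apply/matrixP => y z; rewrite !mxE; congr (v (t _) _); exact: val_inj.
rewrite add0r.
pose f (i : 'I_(q.+1 + p)) : 'I_(p + q).+1 :=
  match fintype.split i with
  | inl j => if unlift ord0 j is Some k then lift ord0 (rshift p k) else ord0
  | inr k => lift ord0 (lshift q k)
  end.
have fl0 : f (lshift p ord0) = ord0.
  by rewrite /f -[lshift _ _]/(unsplit (inl _)) unsplitK unlift_none.
have fl (k : 'I_q) : f (lshift p (lift ord0 k)) = lift ord0 (rshift p k).
  by rewrite /f -[lshift _ _]/(unsplit (inl _)) unsplitK liftK.
have fr (k : 'I_p) : f (rshift q.+1 k) = lift ord0 (lshift q k).
  by rewrite /f -[rshift _ _]/(unsplit (inr _)) unsplitK.
have bf : bijective f.
  apply: inj_card_bij; last by rewrite !card_ord addSn addnC.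
  have spl i : [\/ i = lshift p ord0, exists k, i = lshift p (lift ord0 k) |
      exists k, i = rshift q.+1 k].
    rewrite -[i]splitK; case: (fintype.split i) => j /=.
      case: (unliftP ord0 j) => [k|] ->; first by constructor 2; exists k.
      by constructor 1.
    by constructor 3; exists j.
  move=> i j; case: (spl i) => [->|[k ->]|[k ->]];
    case: (spl j) => [->|[l ->]|[l ->]]; rewrite ?fl0 ?fl ?fr //.
  - by move/lift_inj/rshift_inj ->.
  - by move/lift_inj/eqP; rewrite eq_rlshift.
  - by move/lift_inj/eqP; rewrite eq_lrshift.
  - by move/lift_inj/lshift_inj ->.
rewrite -[RHS](altsum_rowsub bf PbE v); apply: eq_bigr => t _.
have -> : row 0 (usubmx (rowsub f (row_perm t v))) = row ord0 (row_perm t v).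
  by apply/rowP => z; rewrite !mxE fl0.
have -> : row' 0 (usubmx (rowsub f (row_perm t v))) =
    dsubmx (row' ord0 (row_perm t v)).
  by apply/matrixP => y z; rewrite !mxE fl.
have -> // : dsubmx (rowsub f (row_perm t v)) = usubmx (row' ord0 (row_perm t v)).
by apply/matrixP => y z; rewrite !mxE fr.
Qed.
End Wedge.

Section Cohomology.
Variables (R : realType) (n : nat).
Implicit Types M N : manifold R n.

Lemma closed_formP M k (w : closed_form M k) :
  form_spec w /\ rform_eq (ext_d w) 0.
Proof. exact/asboolP/(cformP w). Qed.

Lemma cwedge_subproof M p q (a : closed_form M p) (b : closed_form M q) :
  wedge a b \in @is_closed_form R n M (p + q).
Proof.
have [fa da] := closed_formP a; have [fb db] := closed_formP b.
by apply/asboolP; split; [exact: wedge_form|exact: wedge_closed].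
Qed.

Definition cwedge M p q (a : closed_form M p) (b : closed_form M q) :
  closed_form M (p + q) := ClosedForm (cwedge_subproof a b).

Lemma one_form0_subproof M : @one_form0 R n M \in @is_closed_form R n M 0.
Proof.
apply/asboolP; split; last first.
  move=> c x v cx; rewrite /ext_d /one_form0 big1 // => i _.
  by rewrite derive_cst mulr0.
split=> // [c v|c x _ A B C [] //|c x _ A [] //].
exact: (@smooth_on_cst R 'rV[R]_n R _ 1).
Qed.

Definition cone M : closed_form M 0 := ClosedForm (@one_form0_subproof M).

(* [cup] does not depend on the representatives: d(a /\ b) is
   da /\ b + (-1)^p a /\ db. *)
Definition cup M p q (a : deRham M p) (b : deRham M q) : deRham M (p + q) :=
  class_of (cwedge (repr a) (repr b)).

(* The degree of [cup a (cup_pow a r)] is [2 + r.*2], which is convertible to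
   [r.+1.*2]. *)
Fixpoint cup_pow M (a : deRham M 2) (r : nat) : deRham M r.*2 :=
  if r is r'.+1 then cup a (cup_pow a r') else class_of (cone M).

Definition lefschetz M (a : deRham M 2) (r p q : nat) (e : (r.*2 + p = q)%N)
    (b : deRham M p) : deRham M q :=
  ecast k (deRham M k) e (cup (cup_pow a r) b).

Definition nondegenerate M (w : rform M 2) : Prop :=
  forall (c : atlas M) x, img c x ->
    forall u : 'rV[R]_n, u != 0 -> exists v : 'rV[R]_n, w c x (col_mx u v) != 0.

Definition symplectic M (w : closed_form M 2) : Prop := nondegenerate w.

Record riemannian_metric M := RiemannianMetric {
  metric :> atlas M -> 'rV[R]_n -> 'M[R]_n;
  metric_smooth : forall c : atlas M, smooth_on (img c) (metric c);
  metric_sym : forall (c : atlas M) x, img c x -> (metric c x)^T = metric c x;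
  metric_pos : forall (c : atlas M) x, img c x ->
    forall u : 'rV[R]_n, u != 0 -> 0 < (u *m metric c x *m u^T) 0 0;
  metric_compat : forall (c c' : atlas M) x, locdom id setT c c' x ->
    let J := 'J (locrep id c c') x in
    metric c x = J *m metric c' (locrep id c c' x) *m J^T }.

Definition pullback_metric N M (p : N -> M) (g : riemannian_metric M) :
    atlas N -> 'rV[R]_n -> 'M[R]_n := fun c x =>
  let c' := chart_at (p (icoord c x)) in
  let J := 'J (locrep p c c') x in
  J *m g c' (locrep p c c' x) *m J^T.

(* The rows of [E] are an orthonormal frame for the inner product [G]. *)
Definition orthonormal (G E : 'M[R]_n) : Prop := E *m G *m E^T = 1%:M.

(* The norm induced on k-covectors by an inner product, computed in an
   orthonormal frame: the square root of the sum of the squares of the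
   components over increasing k-tuples, or 1/k! of the sum over all k-tuples. *)
Definition covector_norm k (E : 'M[R]_n) (f : 'M[R]_(k, n) -> R) : R :=
  Num.sqrt (k`!%:R^-1 * \sum_(h : {ffun 'I_k -> 'I_n}) f (rowsub h E) ^+ 2).

(* The forms considered are continuous, so the essential supremum is the
   supremum. *)
Definition Linf_norm N (G : atlas N -> 'rV[R]_n -> 'M[R]_n) k (w : rform N k) :
    \bar R :=
  ereal_sup [set y | exists (c : atlas N) x E,
    [/\ img c x, orthonormal (G c x) E & y = (covector_norm E (w c x))%:E]].

(* In degree 0 the only candidate for a primitive is 0. *)
Definition dtilde_bounded N M (p : N -> M) (g : riemannian_metric M) k :
    rform M k -> Prop :=
  match k with
  | 0 => fun w => rform_eq (pullback p w) 0
  | k'.+1 => fun w => exists G : rform N k',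
      [/\ form_spec G, rform_eq (pullback p w) (ext_d G) &
          (Linf_norm (pullback_metric p g) G < +oo)%E]
  end.

(* On a compact M this set does not depend on the metric g. *)
Definition Vdtilde N M (p : N -> M) (g : riemannian_metric M) k :
    set (deRham M k) :=
  [set class_of w | w in [set w : closed_form M k | dtilde_bounded p g w]].

End Cohomology.

Arguments Vdtilde {R n N M} p g k.

Lemma lefschetz_degree m p : (p <= m)%N -> ((m - p).*2 + p = m.*2 - p)%N.
Proof.
move=> /subnK; move: (m - p)%N => k <-.
by rewrite doubleD -(addnn p) addnA addnK.
Qed.

Definition hard_lefschetz (R : realType) (m : nat) (M : manifold R m.*2)
    (a : deRham M 2) : Prop :=
  forall p (pm : (p <= m)%N), bijective (lefschetz a (lefschetz_degree pm)).

(* Main.v *)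
(* Let [w] be a closed form in the class [a^r] with [p^* w = d Gamma] and [Gamma]
   bounded.  For a closed form [b],
     p^*(w /\ b) = d Gamma /\ p^* b = d (Gamma /\ p^* b)
   and [Gamma /\ p^* b] is bounded, since [b] is bounded on the compact manifold
   and pulling back preserves pointwise norms.  So [a^r] times any class lies in
   [V], and surjectivity of [L_a^r] gives the first part.  For the second part, put
   [i = 2n - q]: [n - i = q - n >= r], and the surjective map [L_a^(n - i)] factors
   as [L_a^r] after [L_a^(q - n - r)].

   Products and exterior derivatives are handled through the alternation
   [alt f v = sum_s (-1)^s f (s v)]: up to factorials, [a /\ b] is the alternation of
   [a (x) b] and [d w] that of [(v_0, ..., v_k) |-> D_(v_0) w (v_1, ..., v_k)].
   Associativity and the Leibniz rule then follow from
   [alt (alt f (x) g) = p! alt (f (x) g)]. *)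

From mathcomp Require Import all_boot all_order all_algebra all_fingroup.
From mathcomp Require Import all_classical all_reals all_analysis.
From mathcomp Require Import generic_quotient.
From mathcomp Require Import zify.
Require Import Defs.

Set Implicit Arguments.
Unset Strict Implicit.
Unset Printing Implicit Defensive.

Import Order.TTheory GRing.Theory Num.Theory numFieldNormedType.Exports.

Local Open Scope classical_set_scope.
Local Open Scope ring_scope.

(** * Alternation of multilinear functions *)

Section MultilinearAlgebra.
Variables (R : realType) (n : nat).

(** Replacing row [i] by [u] turns the relational definition of multilinearity into equations that
    can be rewritten. *)
Definition rset k (i : 'I_k) (u : 'rV[R]_n) (A : 'M[R]_(k, n)) : 'M[R]_(k, n) :=
  \matrix_(l, j) if l == i then u 0 j else A l j.

Lemma row_rset k (i : 'I_k) u A : row i (rset i u A) = u.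
Proof. by apply/rowP => j; rewrite !mxE eqxx. Qed.

Lemma row'_rset k (i : 'I_k) u A : row' i (rset i u A) = row' i A.
Proof. by apply/matrixP => l j; rewrite !mxE eq_sym (negbTE (neq_lift _ _)). Qed.

Lemma rset_id k (i : 'I_k) A : rset i (row i A) A = A.
Proof. by apply/matrixP => l j; rewrite !mxE; case: eqP => // ->. Qed.

Section Multilinear.
Variables (k : nat) (f : 'M[R]_(k, n) -> R).
Hypothesis f_lin : multilinear f.

Lemma multilinear_rset i b c u w A :
  f (rset i (b *: u + c *: w) A) = b * f (rset i u A) + c * f (rset i w A).
Proof. by apply: (f_lin (i := i)); rewrite ?row_rset ?row'_rset. Qed.

Lemma multilinear_rset_sum i (I : finType) (c : I -> R) (u : I -> 'rV[R]_n) A :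
  f (rset i (\sum_j c j *: u j) A) = \sum_j c j * f (rset i (u j) A).
Proof.
elim/big_ind2 : _ => [|x a y b xa yb|j _].
- by rewrite -[0 in LHS](addr0 0) -[0](scale0r 0) multilinear_rset !mul0r addr0.
- by rewrite -xa -yb -[a in LHS]scale1r -[b in LHS]scale1r multilinear_rset !mul1r.
- by rewrite -[_ *: _]addr0 -[X in _ + X](scale0r 0) multilinear_rset mul0r addr0.
Qed.

Lemma multilinear_expand A :
  f A = \sum_(h : {ffun 'I_k -> 'I_n}) (\prod_i A i (h i)) * f (rowsub h 1%:M).
Proof.
(* Rows are expanded in the standard basis one at a time: those of index at least [m] are already
   basis vectors. For [m = k] this is no condition on [B]; for [m = 0] a single [h] contributes. *)
suff H m B : (forall i : 'I_k, (m <= i)%N ->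
    exists j, row i B = delta_mx 0 j) ->
    f B = \sum_(h : {ffun 'I_k -> 'I_n}) (\prod_i B i (h i)) * f (rowsub h 1%:M).
  by apply: (H k) => i; rewrite leqNgt ltn_ord.
elim: m B => [|m IH] B HB.
  have [h0 hE] : exists h0 : {ffun 'I_k -> 'I_n}, forall i,
      row i B = delta_mx 0 (h0 i).
    have /choice[h0 H0] : forall i : 'I_k, exists j, row i B = delta_mx 0 j.
      by move=> i; exact: HB.
    by exists [ffun i => h0 i] => i; rewrite ffunE.
  have BE i j : B i j = (j == h0 i)%:R.
    by have /rowP/(_ j) := hE i; rewrite !mxE eqxx.
  rewrite (bigD1 h0) //= big1 ?mul1r => [|i _]; last by rewrite BE eqxx.
  rewrite big1 ?addr0 => [|h hh0].
    congr f; apply/matrixP => i j; rewrite !mxE BE eq_sym.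
    by congr (_%:R).
  have [i hi] : exists i, h i != h0 i.
    apply/existsP; apply: contraNT hh0; rewrite negb_exists => /forallP H.
    by apply/eqP/ffunP => i; apply/eqP; have := H i; rewrite negbK.
  by rewrite (bigD1 i) //= BE (negbTE hi) !mul0r.
have [km|mk] := leqP k m.
  by apply: IH => i mi; have := leq_trans km mi; rewrite leqNgt ltn_ord.
pose i0 := Ordinal mk.
have B0 j i : (rset i0 (delta_mx 0 j) B) i =1
    if i == i0 then fun l => (l == j)%:R else B i.
  by move=> l; rewrite !mxE; case: eqP => //; rewrite mxE eqxx.
rewrite -[in LHS](rset_id i0 B) [in LHS](row_sum_delta (row i0 B)).
rewrite multilinear_rset_sum.
transitivity (\sum_j B i0 j * \sum_(h : {ffun 'I_k -> 'I_n})
    (\prod_i (rset i0 (delta_mx 0 j) B) i (h i)) * f (rowsub h 1%:M)).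
  apply: eq_bigr => j _; rewrite mxE; congr (_ * _).
  apply: IH => i mi; have [->|ii0] := eqVneq i i0.
    by exists j; rewrite row_rset.
  have [|l lE] := HB i.
    rewrite ltn_neqAle mi andbT; apply: contra_neq ii0 => mi0.
    by apply: val_inj.
  exists l; rewrite -lE; apply/rowP => z.
  by rewrite !mxE (negbTE ii0).
under eq_bigr do rewrite mulr_sumr.
rewrite exchange_big /=; apply: eq_bigr => h _.
under eq_bigr do rewrite mulrA.
rewrite -mulr_suml; congr (_ * _).
rewrite (bigD1 (h i0)) //= [X in _ + X]big1 ?addr0 => [|j jh]; last first.
  by rewrite (bigD1 i0) //= B0 eqxx eq_sym (negbTE jh) mul0r mulr0.
rewrite (bigD1 i0) //= B0 eqxx eqxx mul1r [RHS](bigD1 i0) //=; congr (_ * _).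
by apply: eq_bigr => i ii0; rewrite B0 (negbTE ii0).
Qed.

Hypothesis f_alt : alternating f.

(** A permutation is a product of transpositions. For one transposition, expand [f] with [a + b] in
    both rows: the terms with equal rows vanish, and the two mixed ones are opposite. *)
Lemma alternating_perm (s : 'S_k) A : f (row_perm s A) = (-1) ^+ s * f A.
Proof.
have f_tperm i j B : i != j -> f (row_perm (tperm i j) B) = - f B.
  move=> ij; set a := row i B; set b := row j B.
  have ji : j != i by rewrite eq_sym.
  pose C u w := rset i u (rset j w B).
  have rowj u w : row j (C u w) = w.
    by apply/rowP => l; rewrite !mxE (negbTE ji) eqxx.
  have CC u w : C u w = rset j w (rset i u B).
    apply/matrixP => l z; rewrite !mxE.
    by case: (eqVneq l i) => // ->; rewrite (negbTE ij).
  have C0 u : f (C u u) = 0.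
    by apply: (f_alt ij); rewrite rowj row_rset.
  have := C0 (1 *: a + 1 *: b); rewrite multilinear_rset -!/(C _ _).
  rewrite !CC !multilinear_rset -!CC !C0 !mul1r add0r addr0 => /eqP.
  rewrite addrC addr_eq0 => /eqP E.
  have -> : row_perm (tperm i j) B = C b a.
    apply/matrixP => l z; rewrite !mxE.
    by case: tpermP => [->|->|/eqP/negbTE-> /eqP/negbTE->] //;
      rewrite ?eqxx ?(negbTE ji).
  rewrite E; congr (- f _).
  by rewrite /C /b rset_id /a rset_id.
have [ts -> _] := prod_tpermP s.
elim: ts A => [|[i j] ts IH] B; first by rewrite big_nil odd_perm1 row_perm1 mul1r.
rewrite big_cons row_permM odd_permM odd_tperm /=.
have [->|ij] := eqVneq i j.
  by rewrite tperm1 row_perm1 IH.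
by rewrite f_tperm // IH signrN mulNr.
Qed.

End Multilinear.

(** The sum is not divided by [N!]; hence the factorials in the lemmas below. *)
Definition alt N (f : 'M[R]_(N, n) -> R) (v : 'M[R]_(N, n)) : R :=
  \sum_(s : 'S_N) (-1) ^+ s * f (row_perm s v).

Definition tens p q (f : 'M[R]_(p, n) -> R) (g : 'M[R]_(q, n) -> R)
    (v : 'M[R]_(p + q, n)) : R :=
  f (usubmx v) * g (dsubmx v).

Lemma eq_alt N (f g : 'M[R]_(N, n) -> R) : f =1 g -> alt f =1 alt g.
Proof. by move=> fg v; apply: eq_bigr => s _; rewrite fg. Qed.

Lemma altZ N a (f : 'M[R]_(N, n) -> R) v :
  alt (fun w => a * f w) v = a * alt f v.
Proof. by rewrite mulr_sumr; apply: eq_bigr => s _; rewrite mulrCA. Qed.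

Lemma altD N (f g : 'M[R]_(N, n) -> R) v :
  alt (fun w => f w + g w) v = alt f v + alt g v.
Proof. by rewrite -big_split; apply: eq_bigr => s _; rewrite mulrDr. Qed.

Lemma alt_sum N (I : finType) (F : I -> 'M[R]_(N, n) -> R) v :
  alt (fun w => \sum_i F i w) v = \sum_i alt (F i) v.
Proof.
by rewrite exchange_big; apply: eq_bigr => s _; rewrite mulr_sumr.
Qed.

Lemma alt_comp N (f : 'M[R]_(N, n) -> R) (t : 'S_N) v :
  alt (fun w => f (row_perm t w)) v = (-1) ^+ t * alt f v.
Proof.
rewrite /alt [in RHS](reindex_inj (mulgI t)) mulr_sumr; apply: eq_bigr => s _.
by rewrite -row_permM odd_permM signr_addb !mulrA -expr2 sqrr_sign mul1r.
Qed.

Lemma alt_alternating N (f : 'M[R]_(N, n) -> R) v :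
  multilinear f -> alternating f -> alt f v = N`!%:R * f v.
Proof.
move=> fl fa; rewrite /alt.
under eq_bigr do rewrite alternating_perm // mulrA -expr2 sqrr_sign mul1r.
by rewrite sumr_const card_Sn mulr_natl.
Qed.

(** Building the extension of [s] from a factorization into transpositions yields its sign along the
    way. *)
Lemma perm_lshift p q (s : 'S_p) : exists S : 'S_(p + q),
  [/\ (S : bool) = s, forall i, S (lshift q i) = lshift q (s i) &
      forall j, S (rshift p j) = rshift p j].
Proof.
have [ts -> _] := prod_tpermP s.
elim: ts => [|[x y] ts [S [oS lS rS]]].
  by exists 1%g; rewrite big_nil !odd_perm1; split=> // i; rewrite !perm1.
exists (tperm (lshift q x) (lshift q y) * S)%g; rewrite big_cons; split=> [|i|j].
- by rewrite !odd_permM !odd_tperm oS (inj_eq (@lshift_inj _ _)).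
- by rewrite !permM -(inj_tperm _ _ _ (@lshift_inj _ _)) lS.
- by rewrite permM tpermD ?rS // eq_lrshift.
Qed.

Lemma perm_rshift p q (s : 'S_q) : exists S : 'S_(p + q),
  [/\ (S : bool) = s, forall i, S (lshift q i) = lshift q i &
      forall j, S (rshift p j) = rshift p (s j)].
Proof.
have [ts -> _] := prod_tpermP s.
elim: ts => [|[x y] ts [S [oS lS rS]]].
  by exists 1%g; rewrite big_nil !odd_perm1; split=> // i; rewrite !perm1.
exists (tperm (rshift p x) (rshift p y) * S)%g; rewrite big_cons; split=> [|i|j].
- by rewrite !odd_permM !odd_tperm oS (inj_eq (@rshift_inj _ _)).
- by rewrite permM tpermD ?lS // eq_rlshift.
- by rewrite !permM -(inj_tperm _ _ _ (@rshift_inj _ _)) rS.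
Qed.

(** Each of the [p!] permutations of the first block extends to all [p + q] indices with the same
    sign. Reindexing the outer alternation absorbs it, and the two signs cancel. *)
Lemma alt_tensl p q (f : 'M[R]_(p, n) -> R) (g : 'M[R]_(q, n) -> R) v :
  alt (tens (alt f) g) v = p`!%:R * alt (tens f g) v.
Proof.
rewrite (@eq_alt _ _ (fun w => \sum_(s : 'S_p) (-1) ^+ s *
    (f (row_perm s (usubmx w)) * g (dsubmx w)))); last first.
  by move=> w; rewrite /tens mulr_suml; apply: eq_bigr => s _; rewrite mulrA.
rewrite alt_sum (eq_bigr (fun=> alt (tens f g) v)) => [|s _].
  by rewrite sumr_const card_Sn mulr_natl.
have [S [oS lS rS]] := perm_lshift q s.
rewrite altZ (@eq_alt _ _ (fun w => tens f g (row_perm S w))) => [|w].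
  by rewrite alt_comp oS mulrA -expr2 sqrr_sign mul1r.
by rewrite /tens; congr (f _ * g _); apply/matrixP => i j; rewrite !mxE ?lS ?rS.
Qed.

Lemma alt_tensr p q (f : 'M[R]_(p, n) -> R) (g : 'M[R]_(q, n) -> R) v :
  alt (tens f (alt g)) v = q`!%:R * alt (tens f g) v.
Proof.
rewrite (@eq_alt _ _ (fun w => \sum_(s : 'S_q) (-1) ^+ s *
    (f (usubmx w) * g (row_perm s (dsubmx w))))); last first.
  by move=> w; rewrite /tens mulr_sumr; apply: eq_bigr => s _; rewrite mulrCA.
rewrite alt_sum (eq_bigr (fun=> alt (tens f g) v)) => [|s _].
  by rewrite sumr_const card_Sn mulr_natl.
have [S [oS lS rS]] := perm_rshift p s.
rewrite altZ (@eq_alt _ _ (fun w => tens f g (row_perm S w))) => [|w].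
  by rewrite alt_comp oS mulrA -expr2 sqrr_sign mul1r.
by rewrite /tens; congr (f _ * g _); apply/matrixP => i j; rewrite !mxE ?lS ?rS.
Qed.

Lemma alt_cast N N' (e : N = N') (f : 'M[R]_(N, n) -> R) v :
  alt (fun w : 'M[R]_(N', n) => f (castmx (esym e, erefl) w)) v =
  alt f (castmx (esym e, erefl) v).
Proof. by case: N' / e v => v; apply: eq_alt => w; rewrite castmx_id. Qed.

End MultilinearAlgebra.

(** * Leibniz rule and associativity of the wedge product *)

Section Leibniz.
Variables (R : realType) (n : nat).

(** The inner permutations act on the indices other than [0]; extended so as to fix [0], they are
    absorbed by the outer alternation. *)
Lemma alt_lift N (g : 'rV[R]_n -> 'M[R]_(N, n) -> R) (v : 'M[R]_(N.+1, n)) :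
  alt (fun w : 'M[R]_(N.+1, n) => alt (g (row ord0 w)) (row' ord0 w)) v =
  N`!%:R * alt (fun w : 'M[R]_(N.+1, n) => g (row ord0 w) (row' ord0 w)) v.
Proof.
rewrite alt_sum (eq_bigr (fun=> alt (fun w : 'M[R]_(N.+1, n) =>
    g (row ord0 w) (row' ord0 w)) v)) => [|s _].
  by rewrite sumr_const card_Sn mulr_natl.
pose S := lift_perm ord0 ord0 s.
have oS : (S : bool) = s by rewrite odd_lift_perm.
rewrite altZ (@eq_alt _ _ _ _ (fun w : 'M[R]_(N.+1, n) =>
    g (row ord0 (row_perm S w)) (row' ord0 (row_perm S w)))) => [|w].
  rewrite (alt_comp (fun w : 'M[R]_(N.+1, n) => g (row ord0 w) (row' ord0 w))).
  by rewrite oS mulrA -expr2 sqrr_sign mul1r.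
congr (g _ _); first by apply/rowP => z; rewrite !mxE lift_perm_id.
by apply/matrixP => i j; rewrite !mxE lift_perm_lift.
Qed.

Variable M : manifold R n.

(** Row [0] is the direction of differentiation, the other rows are the arguments of [w]. This
    tensor is only alternating in the latter. *)
Definition pd k (w : rform M k) (c : atlas M) x (v : 'M[R]_(k.+1, n)) : R :=
  'D_(row ord0 v) (fun y => w c y (row' ord0 v)) x.

Lemma derive_row_perm k (w : rform M k) (c : atlas M) x (s : 'S_k) u v :
  form_spec w -> img c x ->
  'D_u (fun y => w c y (row_perm s v)) x = (-1) ^+ s * 'D_u (fun y => w c y v) x.
Proof.
move=> fw cx; rewrite -[RHS]/((-1) ^+ s *: _) -deriveZ; last exact: form_derivable.
apply: near_eq_derive.
apply: filterS (open_nbhs_nbhs (conj (@img_open R n M c) cx)) => y cy.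
by rewrite (alternating_perm (form_multilinear fw cy) (form_alternating fw cy)).
Qed.

(** A permutation of [k + 1] indices amounts to the image [i] of [0] and a permutation of the rest.
    For fixed [i] the [k!] permutations contribute equally, because [w] is alternating. *)
Lemma alt_pd k (w : rform M k) (c : atlas M) x v : form_spec w -> img c x ->
  alt (pd w c x) v = k`!%:R * ext_d w c x v.
Proof.
move=> fw cx; rewrite /alt (reindex (fun z : 'I_k.+1 * 'S_k =>
    lift_perm ord0 z.1 z.2)) /=; last first.
  apply: onW_bij; apply: inj_card_bij => [[i s] [j t] /= E|].
    have ij : i = j by rewrite -(lift_perm_id ord0 i s) E lift_perm_id.
    congr (_, _); first exact: ij.
    apply/permP => l; apply: (@lift_inj _ i).
    by rewrite -(lift_perm_lift ord0) E lift_perm_lift ij.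
  by rewrite card_prod card_ord !card_Sn factS.
rewrite -(pair_bigA _ (fun i s => (-1) ^+ (lift_perm ord0 i s) *
  pd w c x (row_perm (lift_perm ord0 i s) v))) /= mulr_sumr.
apply: eq_bigr => i _.
rewrite (eq_bigr (fun=> (-1) ^+ i * 'D_(row i v) (fun y => w c y (row' i v)) x)).
  by rewrite sumr_const card_Sn mulr_natl.
move=> s _; rewrite /pd.
have -> : row ord0 (row_perm (lift_perm ord0 i s) v) = row i v.
  by apply/rowP => z; rewrite !mxE lift_perm_id.
have -> : row' ord0 (row_perm (lift_perm ord0 i s) v) = row_perm s (row' i v).
  by apply/matrixP => y z; rewrite !mxE lift_perm_lift.
rewrite derive_row_perm // odd_lift_perm /= signr_addb signr_odd mulrA.
by rewrite -(mulrA ((-1) ^+ i)) -expr2 sqrr_sign mulr1.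
Qed.

Lemma wedge_alt p q (a : rform M p) (b : rform M q) (c : atlas M) x v :
  wedge a b c x v = (p`! * q`!)%:R^-1 * alt (tens (a c x) (b c x)) v.
Proof. by []. Qed.

Lemma derive_wedge p q (a : rform M p) (b : rform M q) (c : atlas M) x u w :
  form_spec a -> form_spec b -> img c x ->
  'D_u (fun y => wedge a b c y w) x = (p`! * q`!)%:R^-1 * alt (fun w =>
     'D_u (fun y => a c y (usubmx w)) x * b c x (dsubmx w) +
     a c x (usubmx w) * 'D_u (fun y => b c y (dsubmx w)) x) w.
Proof.
move=> fa fb cx.
pose F (s : 'S_(p + q)) : 'rV[R]_n -> R := (-1) ^+ s *:
  ((fun x => a c x (usubmx (row_perm s w))) *
   (fun x => b c x (dsubmx (row_perm s w)))).
have -> : (fun y => wedge a b c y w) =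
    ((p`! * q`!)%:R^-1 : R) *: (\sum_s F s).
  apply/funext => y; rewrite /wedge /F.
  by rewrite [RHS]/GRing.scale /= fct_sumE.
have da s : derivable (fun y => a c y (usubmx (row_perm s w))) x u.
  exact: form_derivable.
have db s : derivable (fun y => b c y (dsubmx (row_perm s w))) x u.
  exact: form_derivable.
have dab s := derivableM (da s) (db s).
have dF s : is_derive x u (F s) ((-1) ^+ s *
    ('D_u (fun y => a c y (usubmx (row_perm s w))) x *
       b c x (dsubmx (row_perm s w)) + a c x (usubmx (row_perm s w)) *
       'D_u (fun y => b c y (dsubmx (row_perm s w))) x)).
  apply: DeriveDef; first by apply: derivableZ; exact: dab.
  rewrite deriveZ; last exact: dab.
  rewrite (deriveM (da s) (db s)); congr (_ * _).
  by rewrite addrC; congr (_ + _); exact: mulrC.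
have [dS ES] : is_derive x u (\sum_s F s) (\sum_(s : 'S_(p + q)) (-1) ^+ s *
    ('D_u (fun y => a c y (usubmx (row_perm s w))) x *
       b c x (dsubmx (row_perm s w)) + a c x (usubmx (row_perm s w)) *
       'D_u (fun y => b c y (dsubmx (row_perm s w))) x)).
  elim/big_ind2 : _ => // [|f f' g g' df dg]; first exact: is_derive_cst.
  exact: is_deriveD.
by rewrite deriveZ // ES.
Qed.

Lemma tens_pdr p q (a : 'M[R]_(p, n) -> R) (b : rform M q) (c : atlas M) x v :
  alt (fun w : 'M[R]_((p + q).+1, n) => a (usubmx (row' ord0 w)) *
    'D_(row ord0 w) (fun y => b c y (dsubmx (row' ord0 w))) x) v =
  (-1) ^+ p *
    alt (tens a (pd b c x)) (castmx (esym (addnS p q), erefl) v).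
Proof.
have lt_p : (p < (p + q).+1)%N by rewrite ltnS leq_addr.
(* The cycle that moves the direction of differentiation past the [p] arguments of [a]: it sends
   position [p] to [0] and keeps the order of the others, so its sign is [(-1)^p]. *)
pose rho : 'S_(p + q).+1 := lift_perm (Ordinal lt_p) ord0 1.
have orho : (-1) ^+ rho = (-1) ^+ p :> R.
  by rewrite odd_lift_perm odd_perm1 !addbF signr_odd.
rewrite -alt_cast -orho -alt_comp; apply: eq_alt => w; rewrite /tens /pd.
have rhoL (i : 'I_p) : rho (cast_ord (addnS p q) (lshift q.+1 i)) =
    lift ord0 (lshift q i).
  have -> : cast_ord (addnS p q) (lshift q.+1 i) =
      lift (Ordinal lt_p) (lshift q i).
    by apply: val_inj; rewrite /= /bump leqNgt ltn_ord.
  by rewrite lift_perm_lift perm1.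
have rho0 : rho (cast_ord (addnS p q) (rshift p ord0)) = ord0.
  have -> : cast_ord (addnS p q) (rshift p ord0) = Ordinal lt_p.
    by apply: val_inj; rewrite /= addn0.
  by rewrite lift_perm_id.
have rhoR (i : 'I_q) : rho (cast_ord (addnS p q) (rshift p (lift ord0 i))) =
    lift ord0 (rshift p i).
  have -> : cast_ord (addnS p q) (rshift p (lift ord0 i)) =
      lift (Ordinal lt_p) (rshift p i).
    by apply: val_inj; rewrite /= /bump leq_addr !add1n addnS.
  by rewrite lift_perm_lift perm1.
have cE (z : 'M[R]_((p + q).+1, n)) i j :
    castmx (esym (addnS p q), erefl) z i j = z (cast_ord (addnS p q) i) j.
  by rewrite castmxE /= cast_ord_id esymK.
congr (a _ * _).
  by apply/matrixP => i j; rewrite !mxE cE !mxE rhoL.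
congr ('D_ _ _ _); last by apply/rowP => j; rewrite !mxE cE !mxE rho0.
apply/funext => y; congr (b c y _).
by apply/matrixP => i j; rewrite !mxE cE !mxE rhoR.
Qed.

Lemma factR_neq0 k : k`!%:R != 0 :> R.
Proof. by rewrite pnatr_eq0 -lt0n fact_gt0. Qed.

(** After multiplication by [p!] the exterior derivative becomes an alternation inside a tensor
    product, which [alt_tensl] removes at the cost of [(p + 1)!]. *)
Lemma tens_ext_dl p q (a : rform M p) (b : 'M[R]_(q, n) -> R) (c : atlas M) x v :
  form_spec a -> img c x ->
  alt (tens (ext_d a c x) b) v = p.+1%:R * alt (tens (pd a c x) b) v.
Proof.
move=> fa cx; apply: (mulfI (factR_neq0 p)).
rewrite -(altZ p`!%:R) (@eq_alt _ _ _ _ (tens (alt (pd a c x)) b)) => [|w].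
  by rewrite alt_tensl factS natrM mulrCA mulrA.
by rewrite /tens alt_pd // mulrA.
Qed.

Lemma tens_ext_dr p q (a : 'M[R]_(p, n) -> R) (b : rform M q) (c : atlas M) x v :
  form_spec b -> img c x ->
  alt (tens a (ext_d b c x)) v = q.+1%:R * alt (tens a (pd b c x)) v.
Proof.
move=> fb cx; apply: (mulfI (factR_neq0 q)).
rewrite -(altZ q`!%:R) (@eq_alt _ _ _ _ (tens a (alt (pd b c x)))) => [|w].
  by rewrite alt_tensr factS natrM mulrCA mulrA.
by rewrite /tens alt_pd // mulrCA.
Qed.

(** The degree [p.+1 + q] of the first term is convertible to [(p + q).+1], while [p + q.+1] is not;
    hence the cast in the second term. *)
Lemma ext_d_wedge p q (a : rform M p) (b : rform M q) (c : atlas M) x v :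
  form_spec a -> form_spec b -> img c x ->
  ext_d (wedge a b) c x v = wedge (ext_d a) b c x v +
    (-1) ^+ p * wedge a (ext_d b) c x (castmx (esym (addnS p q), erefl) v).
Proof.
(* Multiplied by [(p + q)!], the left side is an alternation of derivatives of a wedge, which are
   themselves alternations; [alt_lift] merges the two layers. *)
move=> fa fb cx; apply: (mulfI (factR_neq0 (p + q))).
rewrite -alt_pd //; last exact: wedge_form.
rewrite (@eq_alt _ _ _ _ _ (fun w => derive_wedge _ _ fa fb cx)) altZ.
rewrite (alt_lift (fun u w => 'D_u (fun y => a c y (usubmx w)) x *
  b c x (dsubmx w) + a c x (usubmx w) * 'D_u (fun y => b c y (dsubmx w)) x)).
rewrite mulrCA; congr (_ * _); rewrite altD tens_pdr mulrDr; congr (_ + _).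
  rewrite wedge_alt tens_ext_dl // mulrA; congr (_ * _).
    by rewrite factS -mulnA (natrM _ p.+1) invfM mulrAC mulVf ?mul1r // pnatr_eq0.
  apply: eq_alt => w; rewrite /tens /pd; congr (_ * b c x _).
    congr ('D_ _ _ _); last by apply/rowP => j; rewrite !mxE; congr (w _ _);
      exact: val_inj.
    apply/funext => y; congr (a c y _).
    by apply/matrixP => i j; rewrite !mxE; congr (w _ _); exact: val_inj.
  by apply/matrixP => i j; rewrite !mxE; congr (w _ _); exact: val_inj.
rewrite wedge_alt tens_ext_dr // mulrCA; congr (_ * _); rewrite mulrA; congr (_ * _).
by rewrite factS mulnCA (natrM _ q.+1) invfM mulrAC mulVf ?mul1r // pnatr_eq0.
Qed.

(** Both sides equal [1 / (p! q! r!)] times the alternation of the threefold tensor product. *)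
Lemma wedgeA p q r (a : rform M p) (b : rform M q) (d : rform M r)
    (c : atlas M) x v :
  wedge (wedge a b) d c x v =
  wedge a (wedge b d) c x (castmx (esym (addnA p q r), erefl) v).
Proof.
transitivity ((p`! * q`! * r`!)%:R^-1 *
    alt (tens (tens (a c x) (b c x)) (d c x)) v).
  rewrite wedge_alt (@eq_alt _ _ _ _ (fun w => (p`! * q`!)%:R^-1 *
    tens (alt (tens (a c x) (b c x))) (d c x) w)) => [|w]; last first.
    by rewrite /tens wedge_alt mulrA.
  rewrite altZ alt_tensl !natrM !invfM.
  rewrite !mulrA; congr (_ * _); rewrite [LHS]mulrC !mulrA.
  by rewrite divff ?factR_neq0 // mul1r -mulrA mulrC.
rewrite [RHS]wedge_alt (@eq_alt _ _ _ (tens _ (wedge b d c x)) (fun w =>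
    (q`! * r`!)%:R^-1 *
    tens (a c x) (alt (tens (b c x) (d c x))) w)) => [|w]; last first.
  by rewrite /tens wedge_alt mulrCA.
rewrite altZ alt_tensr !natrM !invfM -alt_cast.
rewrite -!mulrA; congr (_ * _).
rewrite [in RHS](mulrCA r`!%:R^-1) [in RHS](mulrCA q`!%:R^-1) mulKf ?factR_neq0 //.
congr (_ * (_ * _)); apply: eq_alt => w.
have cE i j : castmx (esym (addnA p q r), erefl) w i j =
    w (cast_ord (addnA p q r) i) j.
  by rewrite castmxE /= cast_ord_id esymK.
rewrite /tens -mulrA; congr (a c x _ * (b c x _ * d c x _));
  apply/matrixP => i j; rewrite !mxE cE; congr (w _ _);
  apply: val_inj => //=; by rewrite addnA.
Qed.

End Leibniz.

(** * Cup product *)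

Section CupProduct.
Variables (R : realType) (n : nat) (M : manifold R n).

Lemma rform_eq_wedge p q (a a' : rform M p) (b b' : rform M q) :
  rform_eq a a' -> rform_eq b b' -> rform_eq (wedge a b) (wedge a' b').
Proof.
move=> aa bb c x v cx; rewrite !wedge_alt; congr (_ * _).
by apply: eq_alt => w; rewrite /tens aa // bb.
Qed.

Lemma wedgeBl p q (a a' : rform M p) (b : rform M q) :
  wedge (a - a') b = wedge a b - wedge a' b.
Proof.
apply/funext => c; apply/funext => x; apply/funext => v.
rewrite -[RHS]/(wedge a b c x v - wedge a' b c x v) /wedge -mulrBr -sumrB.
congr (_ * _); apply: eq_bigr => s _.
by rewrite -[(a - a') _ _ _]/(_ - _) mulrBl mulrBr.
Qed.

Lemma wedgeBr p q (a : rform M p) (b b' : rform M q) :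
  wedge a (b - b') = wedge a b - wedge a b'.
Proof.
apply/funext => c; apply/funext => x; apply/funext => v.
rewrite -[RHS]/(wedge a b c x v - wedge a b' c x v) /wedge -mulrBr -sumrB.
congr (_ * _); apply: eq_bigr => s _.
by rewrite -[(b - b') _ _ _]/(_ - _) 2!mulrBr.
Qed.

Lemma wedge0l p q (b : rform M q) : wedge (0 : rform M p) b = 0.
Proof. by rewrite -(subrr 0) wedgeBl subrr. Qed.

Lemma wedge0r p q (a : rform M p) : wedge a (0 : rform M q) = 0.
Proof. by rewrite -(subrr 0) wedgeBr subrr. Qed.

Lemma ext_d_wedge_closedr p q (a : rform M p) (b : rform M q) :
  form_spec a -> form_spec b -> rform_eq (ext_d b) 0 ->
  rform_eq (ext_d (wedge a b)) (wedge (ext_d a) b).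
Proof.
move=> fa fb b0 c x v cx; rewrite ext_d_wedge //.
have aa : rform_eq a a by [].
by rewrite (rform_eq_wedge aa b0) // wedge0r mulr0 addr0.
Qed.

Lemma exact_form_eq k (w e : rform M k) :
  rform_eq w e -> exact_form e -> exact_form w.
Proof.
case: k w e => [|k] w e /= we; first by move=> e0 c x v cx; rewrite we // e0.
by move=> [g fg eg]; exists g => // c x v cx; rewrite we // eg.
Qed.

Lemma exact_form0 k : exact_form (0 : rform M k).
Proof.
case: k => [//|k]; exists 0; first exact: form_spec0.
by move=> c x v cx; rewrite ext_d0.
Qed.

(** For primitives whose derivative has the right degree only up to a provable equality of
    naturals. *)
Lemma exact_form_cast k k' (e : k = k'.+1) (w : rform M k) (g : rform M k') :
  form_spec g ->
  (forall (c : atlas M) x v, img c x ->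
     w c x v = ext_d g c x (castmx (e, erefl) v)) ->
  exact_form w.
Proof.
by subst k => fg wg; exists g.
Qed.

(** If [a = dg] and [b] is closed, then [d(g /\ b) = a /\ b]. In degree [0], exact means zero. *)
Lemma exact_wedgel p q (a : rform M p) (b : rform M q) : form_spec b ->
  rform_eq (ext_d b) 0 -> exact_form a -> exact_form (wedge a b).
Proof.
move=> fb b0; have bb : rform_eq b b by [].
case: p a => [|p] a /=.
  move=> a0; apply: exact_form_eq (rform_eq_wedge a0 bb) _.
  by rewrite wedge0l; exact: exact_form0.
move=> [g fg ag]; apply: exact_form_eq (rform_eq_wedge ag bb) _.
by exists (wedge g b); [exact: wedge_form|
  move=> c x v cx; rewrite ext_d_wedge_closedr].
Qed.

Lemma exact_wedger p q (a : rform M p) (b : rform M q) : form_spec a ->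
  rform_eq (ext_d a) 0 -> exact_form b -> exact_form (wedge a b).
Proof.
move=> fa a0; have aa : rform_eq a a by [].
case: q b => [|q] b /=.
  move=> b0; apply: exact_form_eq (rform_eq_wedge aa b0) _.
  by rewrite wedge0r; exact: exact_form0.
move=> [g fg bg]; apply: exact_form_eq (rform_eq_wedge aa bg) _.
have fag : form_spec (wedge a g) by exact: wedge_form.
(* As [a] is closed, [d(a /\ g) = (-1)^p a /\ dg]; the sign in the primitive compensates. *)
apply: (exact_form_cast (e := addnS p q) (g := (-1) ^+ p *: wedge a g)).
  exact: form_specZ.
move=> c x v cx; rewrite ext_dZ // rformZE ext_d_wedge //.
have gg : rform_eq g g by [].
rewrite (rform_eq_wedge a0 gg) // wedge0l add0r mulrA -expr2 sqrr_sign mul1r.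
by rewrite castmx_comp castmx_id.
Qed.

(** Coordinate expressions carry arbitrary values outside the chart images; the class does not see
    them. *)
Lemma class_of_eq k (w e : closed_form M k) : rform_eq w e -> class_of w = class_of e.
Proof.
move=> we; apply/class_ofP; apply: exact_form_eq (exact_form0 k) => c x v cx.
by rewrite -[LHS]/(cform w c x v - cform e c x v) we // subrr.
Qed.

(** The representatives are exchanged one factor at a time: [(a' - a) /\ b'] and [a /\ (b' - b)] are
    both exact. *)
Lemma cup_class p q (a : closed_form M p) (b : closed_form M q) :
  cup (class_of a) (class_of b) = class_of (cwedge a b).
Proof.
have [fa a0] := closed_formP a.
rewrite /cup; set a' := repr _; set b' := repr _.
have [fb' b'0] := closed_formP b'.
transitivity (class_of (cwedge a b')); apply/class_ofP.
  have /class_ofP aa' : class_of a' = class_of a by exact: reprK.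
  rewrite -[cform _]/(wedge a' b' - wedge a b') -wedgeBl.
  exact: exact_wedgel.
have /class_ofP bb' : class_of b' = class_of b by exact: reprK.
rewrite -[cform _]/(wedge a b' - wedge a b) -wedgeBr.
exact: exact_wedger.
Qed.

(** Classes in degrees that are equal but not convertible are compared in the dependent sum over all
    degrees, which keeps transports out of the statements. *)
Lemma Tagged_class_of k k' (e : k = k') (w : closed_form M k)
    (w' : closed_form M k') :
  (forall (c : atlas M) x v, img c x ->
     cform w c x v = cform w' c x (castmx (e, erefl) v)) ->
  Tagged (deRham M) (class_of w) = Tagged (deRham M) (class_of w').
Proof.
subst k' => ww'; congr Tagged; apply: class_of_eq => c x v cx.
by rewrite ww' // castmx_id.
Qed.

Lemma cupA p q r (x : deRham M p) (y : deRham M q) (z : deRham M r) :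
  Tagged (deRham M) (cup (cup x y) z) = Tagged (deRham M) (cup x (cup y z)).
Proof.
elim/deRham_ind: x => a; elim/deRham_ind: y => b; elim/deRham_ind: z => d.
rewrite !cup_class; apply: (Tagged_class_of (e := esym (addnA p q r))).
by move=> c x v _; exact: wedgeA.
Qed.

(** The alternation of [b] is [p! b], and the normalization of the wedge cancels [p!]. *)
Lemma cup1l p (x : deRham M p) : cup (class_of (cone M)) x = x.
Proof.
elim/deRham_ind: x => b; rewrite cup_class; apply: class_of_eq => c x v cx.
have [fb _] := closed_formP b.
rewrite -[LHS]/(wedge (@one_form0 R n M) b c x v) wedge_alt fact0 mul1n.
rewrite (@eq_alt _ _ _ _ (cform b c x)) => [|w].
  rewrite alt_alternating ?mulKf ?factR_neq0 //.
    exact: form_multilinear.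
  exact: form_alternating.
rewrite /tens mul1r; congr (cform b c x _).
by apply/matrixP => i j; rewrite !mxE; congr (w _ _); exact: val_inj.
Qed.

Lemma Tagged_lefschetz (a : deRham M 2) r p q (e : (r.*2 + p = q)%N) b :
  Tagged (deRham M) (lefschetz a e b) = Tagged (deRham M) (cup (cup_pow a r) b).
Proof. by case: q / e. Qed.

(** Passing to the dependent sum removes the casts; then induction on [r], associativity bringing
    one factor [a] to the front on both sides. *)
Lemma lefschetzD (a : deRham M 2) r s p k q (e : ((r + s).*2 + p = q)%N)
    (e1 : (s.*2 + p = k)%N) (e2 : (r.*2 + k = q)%N) b :
  lefschetz a e b = lefschetz a e2 (lefschetz a e1 b).
Proof.
apply: eq_from_Tagged; rewrite !Tagged_lefschetz.
have -> : Tagged (deRham M) (cup (cup_pow a r) (lefschetz a e1 b)) =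
    Tagged (deRham M) (cup (cup_pow a r) (cup (cup_pow a s) b)).
  by case: k / e1 e2.
elim: r {e e2} => [|r IH]; first by rewrite cup1l.
rewrite (cupA a) (cupA a).
have cup_Tagged i j (x : deRham M i) (y : deRham M j) :
    Tagged (deRham M) x = Tagged (deRham M) y ->
    Tagged (deRham M) (cup a x) = Tagged (deRham M) (cup a y).
  by move=> /(congr1 (fun t => Tagged (deRham M) (cup a (tagged t)))).
exact: cup_Tagged.
Qed.

(** The existential spares a transport of [b] between degrees that agree only by arithmetic. *)
Lemma lefschetz_eq (a : deRham M 2) r r' p p' q (e : (r.*2 + p = q)%N)
    (e' : (r'.*2 + p' = q)%N) b : r = r' -> p = p' ->
  exists b', lefschetz a e b = lefschetz a e' b'.
Proof.
move=> rr pp; subst r' p'; exists b.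
by congr lefschetz; exact: eq_irrelevance.
Qed.

End CupProduct.

(** * Surjectivity from hard Lefschetz *)

Lemma hard_lefschetz_surjective (R : realType) (m : nat) (M : manifold R m.*2)
    (a : deRham M 2) r q (rq : (r.*2 <= q)%N) :
  hard_lefschetz a -> (q <= m.*2)%N -> (m + r <= q)%N ->
  forall c : deRham M q, exists b, lefschetz a (subnKC rq) b = c.
Proof.
move=> hl qm mrq c.
have pm : (m.*2 - q <= m)%N by lia.
(* The target degree is a variable [k], since [m.*2 - (m.*2 - q)] is [q] only by arithmetic. *)
have surj k (e : ((m - (m.*2 - q)).*2 + (m.*2 - q) = k)%N) (x : deRham M k) :
    exists b, lefschetz a e b = x.
  have ek : k = (m.*2 - (m.*2 - q))%N by rewrite -e lefschetz_degree.
  move: e x; rewrite ek => e x; rewrite (eq_irrelevance e (lefschetz_degree pm)).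
  by have [f _ fK] := hl _ pm; exists (f x).
have e : ((m - (m.*2 - q)).*2 + (m.*2 - q) = q)%N by lia.
have e' : ((r + (q - m - r)).*2 + (m.*2 - q) = q)%N by lia.
have e1 : ((q - m - r).*2 + (m.*2 - q) = q - r.*2)%N by lia.
have [b <-] := surj q e c.
have [b' ->] : exists b', lefschetz a e b = lefschetz a e' b'.
  by apply: lefschetz_eq => //; lia.
by exists (lefschetz a e1 b'); rewrite -lefschetzD.
Qed.

(** * Symmetry of second derivatives and composition of smooth maps *)

Section Schwarz.
Variables (R : realType) (V : normedModType R).

Lemma is_derive_line (f : V -> R) (w y : V) (t : R) :
  derivable f (t *: w + y) w ->
  is_derive t 1 (fun s : R => f (s *: w + y)) ('D_w f (t *: w + y)).
Proof.
have E : (fun h : R => h^-1 *: (((fun s : R => f (s *: w + y)) \o shift t) (h *: 1) -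
      f (t *: w + y))) =
    (fun h : R => h^-1 *: ((f \o shift (t *: w + y)) (h *: w) - f (t *: w + y))).
  by apply/funext => h /=; rewrite [h%:A]mulr1 scalerDl addrA.
by move=> df; apply: DeriveDef; rewrite /derivable /derive E.
Qed.

Lemma MVT_line (U : set V) (f : V -> R) (w y : V) (h : R) :
  (forall x, U x -> differentiable f x) -> 0 < h ->
  (forall t, 0 <= t <= h -> U (t *: w + y)) ->
  exists2 t, 0 < t < h & f (h *: w + y) - f y = 'D_w f (t *: w + y) * h.
Proof.
move=> df h0 Uh.
have D t : 0 <= t <= h ->
    is_derive t 1 (fun s : R => f (s *: w + y)) ('D_w f (t *: w + y)).
  by move=> th; apply: is_derive_line; apply: diff_derivable; apply: df; exact: Uh.
have [t|t|t th E] := @MVT R (fun s => f (s *: w + y))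
  (fun t => 'D_w f (t *: w + y)) 0 h h0.
- by rewrite in_itv /= => /andP[t0 th]; apply: D; rewrite !ltW.
- apply: (@continuous_in_subspaceT _ _ `[0, h]%classic).
  move=> {}t; rewrite inE /= in_itv /= => /D Dt.
  by apply: differentiable_continuous; apply/derivable1_diffP.
- exists t; first by move: th; rewrite in_itv.
  by move: E; rewrite scale0r add0r subr0.
Qed.

(** The mean value theorem is applied to the second difference of [f], first along [u], then along
    [v]. *)
Lemma derive_derive_mean (U : set V) (f : V -> R) (u v x : V) (h : R) :
  (forall x, U x -> differentiable f x) ->
  (forall x, U x -> differentiable ('D_u f) x) -> 0 < h ->
  (forall s t, 0 <= s <= h -> 0 <= t <= h -> U (s *: u + (t *: v + x))) ->
  exists s t, [/\ 0 < s < h, 0 < t < h &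
    f (h *: u + (h *: v + x)) - f (h *: u + x) - f (h *: v + x) + f x =
    'D_v ('D_u f) (s *: u + (t *: v + x)) * h * h].
Proof.
move=> df ddf h0 Uh;
have h00 : 0 <= h <= h by rewrite lexx ltW.
have z00 : (0 : R) <= 0 <= h by apply/andP; split=> //; exact: ltW.
have Ux s : 0 <= s <= h -> U (s *: u + x).
  by move=> sh; have := Uh s 0 sh z00; rewrite scale0r add0r.
have D s : 0 <= s <= h ->
    is_derive s 1 (fun s : R => f (s *: u + (h *: v + x)) - f (s *: u + x))
      ('D_u f (s *: u + (h *: v + x)) - 'D_u f (s *: u + x)).
  by move=> sh; apply: is_deriveB; apply: is_derive_line; apply: diff_derivable;
    apply: df; [exact: Uh|exact: Ux].
have [s|s|s sh E] := @MVT R (fun s => f (s *: u + (h *: v + x)) - f (s *: u + x))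
  (fun s => 'D_u f (s *: u + (h *: v + x)) - 'D_u f (s *: u + x)) 0 h h0.
- by rewrite in_itv /= => /andP[t0 th]; apply: D; rewrite !ltW.
- apply: (@continuous_in_subspaceT _ _ `[0, h]%classic).
  move=> {}s; rewrite inE /= in_itv /= => /D Ds.
  by apply: differentiable_continuous; apply/derivable1_diffP.
move: sh; rewrite in_itv /= => sh.
have sh' : 0 <= s <= h by case/andP: sh => *; rewrite !ltW.
have [|t th F] := @MVT_line U ('D_u f) v (s *: u + x) h ddf h0.
  by move=> t th; rewrite addrCA; exact: Uh.
exists s, t; split=> //.
move: E; rewrite !scale0r !add0r subr0 (addrCA (s *: u)) F => E.
by rewrite (addrCA (s *: u)) -E opprB [RHS]addrA [RHS]addrAC.
Qed.

(** The second difference is symmetric in [u] and [v], so the two mixed derivatives agree at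
    suitable, different points near [x]. Their continuity at [x] does the rest. *)
Lemma derive_comm (U : set V) (f : V -> R) (u v x : V) :
  open U -> smooth_on U f -> U x -> 'D_u ('D_v f) x = 'D_v ('D_u f) x.
Proof.
move=> oU sf Ux.
have df y : U y -> differentiable f y by exact: (sf [::]).
have ddf w y : U y -> differentiable ('D_w f) y by exact: (sf [:: w]).
have dddf w w' : {for x, continuous ('D_w ('D_w' f))}.
  by apply: differentiable_continuous; exact: (sf [:: w'; w]).
apply/eqP; rewrite -subr_eq0 -normr_le0; apply/ler_addgt0Pr => e e0.
have e20 : 0 < e / 2 by rewrite divr_gt0.
have /nbhs_ballP[d d0 Hd] : \forall y \near x, [/\ U y,
    `|'D_u ('D_v f) x - 'D_u ('D_v f) y| < e / 2 &
    `|'D_v ('D_u f) x - 'D_v ('D_u f) y| < e / 2].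
  have A1 := open_nbhs_nbhs (conj oU Ux).
  have /cvgrPdist_lt/(_ _ e20) A2 := dddf u v.
  have /cvgrPdist_lt/(_ _ e20) A3 := dddf v u.
  apply: (filterS _ (filterI A1 (filterI A2 A3))) => y [H1 [H2 H3]].
  exact (And3 H1 H2 H3).
(* With this [h] the parallelogram at [x] spanned by [h u] and [h v] lies in the ball of radius [d];
   the [+ 1] keeps the denominator positive. *)
pose h := d / (`|u| + `|v| + 1).
have k0 : 0 < `|u| + `|v| + 1 by rewrite ltr_wpDl // addr_ge0.
have h0 : 0 < h by rewrite divr_gt0.
have Bst s t : 0 <= s <= h -> 0 <= t <= h -> ball x d (s *: u + (t *: v + x)).
  move=> /andP[s0 sh] /andP[t0 th]; rewrite -ball_normE /= addrA opprD addrCA subrr.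
  rewrite addr0 normrN (le_lt_trans (ler_normD _ _)) // !normrZ !ger0_norm //.
  apply: (@le_lt_trans _ _ (h * (`|u| + `|v|))).
    by rewrite mulrDr lerD // ler_wpM2r.
  by rewrite /h mulrAC ltr_pdivrMr // ltr_pM2l // ltrDl.
have ltWW r : 0 < r -> r < h -> 0 <= r <= h by move=> *; rewrite !ltW.
have [|s [t [/andP[s0 sh] /andP[t0 th] E]]] :=
    @derive_derive_mean U f u v x h df (ddf u) h0.
  by move=> s t sh th; have [] := Hd _ (Bst s t sh th).
have [|s' [t' [/andP[s'0 s'h] /andP[t'0 t'h] E']]] :=
    @derive_derive_mean U f v u x h df (ddf v) h0.
  by move=> s' t' sh' th'; rewrite addrCA; have [] := Hd _ (Bst t' s' th' sh').
have [_ _ A2] := Hd _ (Bst s t (ltWW _ s0 sh) (ltWW _ t0 th)).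
have [_ B2 _] := Hd _ (Bst t' s' (ltWW _ t'0 t'h) (ltWW _ s'0 s'h)).
move: E E' A2 B2; rewrite (addrCA (t' *: u)) (addrCA (h *: v)).
move: ('D_v ('D_u f) (_ + _)) ('D_u ('D_v f) (_ + _)) => A B.
move: ('D_v ('D_u f) x) ('D_u ('D_v f) x) => A0 B0 E E' A2 B2.
have AB : A = B.
  have hn0 : h != 0 by rewrite gt_eqF.
  apply: (mulIf hn0); apply: (mulIf hn0); rewrite -E -E'.
  by congr (_ + _); rewrite addrAC.
rewrite add0r -(subrKA B) (le_trans (ler_normD _ _)) // (splitr e) lerD // ltW //.
by rewrite -AB distrC.
Qed.

End Schwarz.

(** * Chain rule and smoothness of composites *)

Section SmoothMaps.
Variables (R : realType).

Lemma smooth_ord_coord (V : normedModType R) m k (U : set V) (F : V -> 'rV[R]_m) j :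
  open U -> smooth_ord k U F -> smooth_ord k U (fun y => F y 0 j).
Proof.
move=> oU; have D (G : V -> 'rV[R]_m) y : differentiable G y ->
    differentiable (fun y => G y 0 j) y.
  by move=> dG; apply: (differentiable_comp (g := fun z : 'rV[R]_m => z 0 j) dG);
    exact: differentiable_coord.
elim: k F => [|k IH] F sF.
  by case=> //= _ x Ux; apply: D; exact: (sF [::]).
have [dF sDF] := (smooth_ordS _ _ _).1 sF.
apply/smooth_ordS; split=> [x Ux|v]; first by apply: D; exact: dF.
apply: (smooth_ord_eq oU _ (IH _ (sDF v))) => x Ux.
by rewrite derive_mx ?mxE //; apply: diff_derivable; exact: dF.
Qed.

Lemma derive_rV_coord (V : normedModType R) m (F : V -> 'rV[R]_m) x v j :
  differentiable F x -> 'D_v (fun y => F y 0 j) x = ('D_v F x) 0 j.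
Proof. by move=> dF; rewrite derive_mx ?mxE //; exact: diff_derivable. Qed.

Lemma derive_comp (V : normedModType R) m (F : V -> 'rV[R]_m) (f : 'rV[R]_m -> R) x v :
  differentiable F x -> differentiable f (F x) ->
  'D_v (f \o F) x = 'D_('D_v F x) f (F x).
Proof.
move=> dF df; rewrite deriveE; last exact: differentiable_comp.
by rewrite diff_comp // /= -(deriveE v dF) -deriveE.
Qed.

Lemma derive_rV_sum m (f : 'rV[R]_m -> R) x v : differentiable f x ->
  'D_v f x = \sum_j v 0 j * 'D_(delta_mx 0 j) f x.
Proof.
move=> df; rewrite deriveE // {1}(row_sum_delta v) linear_sum.
by apply: eq_bigr => j _; rewrite linearZ deriveE.
Qed.

Lemma smooth_ord_sum (V : normedModType R) k (U : set V) I (r : seq I)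
    (F : I -> V -> R) : open U -> (forall i, smooth_ord k U (F i)) ->
  smooth_ord k U (\sum_(i <- r) F i).
Proof.
move=> oU sF; elim/big_ind: _ => //; last by move=> f g; exact: smooth_ordD.
by have /smooth_onP := @smooth_on_cst R V R U 0; exact.
Qed.

Lemma smooth_ord_comp (V : normedModType R) m k (U : set V) (W : set 'rV[R]_m)
    (F : V -> 'rV[R]_m) (f : 'rV[R]_m -> R) : open U ->
  (forall y, U y -> W (F y)) ->
  smooth_ord k U F -> smooth_ord k W f -> smooth_ord k U (f \o F).
Proof.
move=> oU UW; elim: k f => [|k IH] f sF sf.
  case=> //= _ x Ux; apply: differentiable_comp; first exact: (sF [::]).
  by apply: (sf [::]) => //; exact: UW.
have [dF sDF] := (smooth_ordS _ _ _).1 sF.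
have [df sDf] := (smooth_ordS _ _ _).1 sf.
apply/smooth_ordS; split=> [x Ux|v].
  by apply: differentiable_comp; [exact: dF|apply: df; exact: UW].
(* The summands of the chain rule; each is a product of functions that are smooth to the lower order
   [k]. *)
pose G j : V -> R :=
  (fun y => ('D_v F y) 0 j) * ('D_(delta_mx 0 j) f \o F).
apply: (@smooth_ord_eq _ _ _ _ _ (\sum_j G j)) => // [y Uy|].
  rewrite derive_comp; [|exact: dF|by apply: df; exact: UW].
  by rewrite fct_sumE derive_rV_sum //; apply: df; exact: UW.
apply: smooth_ord_sum => // j; apply: smooth_ordM => //.
  exact: smooth_ord_coord.
by apply: IH => //; exact: smooth_ordW.
Qed.

Lemma smooth_on_comp (V : normedModType R) m (U : set V) (W : set 'rV[R]_m)
    (F : V -> 'rV[R]_m) (f : 'rV[R]_m -> R) : open U ->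
  (forall y, U y -> W (F y)) ->
  smooth_on U F -> smooth_on W f -> smooth_on U (f \o F).
Proof.
move=> oU UW /smooth_onP sF /smooth_onP sf; apply/smooth_onP => k.
exact: (smooth_ord_comp oU UW (sF k) (sf k)).
Qed.

Lemma smooth_on_derive (V W : normedModType R) (U : set V) (F : V -> W) v :
  smooth_on U F -> smooth_on U ('D_v F).
Proof. by move=> sF vs; exact: (sF (v :: vs)). Qed.

Lemma smooth_on_coord (V : normedModType R) m (U : set V) (F : V -> 'rV[R]_m) j :
  open U -> smooth_on U F -> smooth_on U (fun y => F y 0 j).
Proof.
move=> oU /smooth_onP sF; apply/smooth_onP => k; exact: smooth_ord_coord.
Qed.

Lemma smooth_on_prod (V : normedModType R) (U : set V) I (r : seq I)
    (F : I -> V -> R) : open U -> (forall i, smooth_on U (F i)) ->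
  smooth_on U (\prod_(i <- r) F i).
Proof.
move=> oU sF; elim/big_ind: _ => //; last by move=> f g; exact: smooth_onM.
exact: (@smooth_on_cst R V R U 1).
Qed.

Lemma smooth_on_local (V W : normedModType R) (U : set V) (f : V -> W) :
  (forall x, U x -> exists2 U', U' x & smooth_on U' f) -> smooth_on U f.
Proof. by move=> H vs x /H[U' U'x]; exact. Qed.

Lemma derive_rV_comm (V : normedModType R) m (U : set V) (F : V -> 'rV[R]_m) u v x :
  open U -> smooth_on U F -> U x -> 'D_u ('D_v F) x = 'D_v ('D_u F) x.
Proof.
move=> oU sF Ux; apply/rowP => j.
have dF w y : U y -> differentiable ('D_w F) y by exact: (sF [:: w]).
have E w w' : ('D_w ('D_w' F) x) 0 j = 'D_w ('D_w' (fun y => F y 0 j)) x.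
  rewrite -derive_rV_coord; last exact: dF.
  apply: near_eq_derive.
  apply: filterS (open_nbhs_nbhs (conj oU Ux)) => y Uy.
  by rewrite derive_rV_coord //; exact: (sF [::]).
apply: etrans (E u v) _; apply: etrans _ (esym (E v u)).
exact: (derive_comm u v oU (smooth_on_coord j oU sF) Ux).
Qed.

(** Vectors are rows, so the Jacobian of the inner map stands on the left. *)
Lemma jacobian_comp m k l (F : 'rV[R]_m -> 'rV[R]_k) (G : 'rV[R]_k -> 'rV[R]_l) x :
  differentiable F x -> differentiable G (F x) ->
  jacobian (G \o F) x = jacobian F x *m jacobian G (F x).
Proof.
move=> dF dG; apply/row_matrixP => i; rewrite !rowE mulmxA.
rewrite -!deriveEjacobian //; last exact: differentiable_comp.
rewrite deriveE; last exact: differentiable_comp.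
by rewrite diff_comp // /= deriveE // deriveE.
Qed.

Lemma near_eq_jacobian m k (F G : 'rV[R]_m -> 'rV[R]_k) x :
  (\forall y \near x, F y = G y) -> differentiable F x ->
  jacobian F x = jacobian G x.
Proof.
move=> FG dF; have dG := near_eq_differentiable FG dF.
apply/row_matrixP => i.
have E (H : 'rV[R]_m -> 'rV[R]_k) : differentiable H x ->
    row i (jacobian H x) = 'D_(delta_mx 0 i) H x.
  by move=> dH; rewrite deriveEjacobian // rowE.
apply: etrans (E F dF) _; apply: etrans _ (esym (E G dG)).
exact: near_eq_derive.
Qed.

End SmoothMaps.

(** * Pullback of forms *)

Section LocalRepresentatives.
Variable R : realType.

Lemma mem_img n (M : topologicalType) (c : chart R n M) m :
  dom c m -> img c (c m).
Proof. by move=> cm; exists m. Qed.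

Lemma near_dom m n (M N : topologicalType) (f : M -> N) (c : chart R m M)
    (c' : chart R n N) x : {in setT, continuous f} -> locdom f setT c c' x ->
  \forall y \near x, locdom f setT c c' y.
Proof.
move=> fc [cx _ c'x].
have cf : {for x, continuous (fun y => f (icoord c y))}.
  apply: continuous_comp; last by apply: fc; rewrite inE.
  by apply: icoord_continuous; rewrite inE.
have c'n : nbhs (f (icoord c x)) (dom c').
  by apply: open_nbhs_nbhs; split=> //; exact: dom_open.
have cn : nbhs x (img c).
  by apply: open_nbhs_nbhs; split=> //; exact: img_open.
near=> y; split=> //; first by near: y.
by near: y; exact: cf c'n.
Unshelve. all: by end_near.
Qed.

Lemma locdom_open m n (M N : topologicalType) (f : M -> N) (c : chart R m M)
    (c' : chart R n N) : {in setT, continuous f} -> open (locdom f setT c c').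
Proof. by move=> fc; rewrite openE => x; exact: near_dom. Qed.

Lemma locrep_comp m n l (L M N : topologicalType) (f : L -> M) (g : M -> N)
    (c0 : chart R m L) (c1 : chart R n M) (c2 : chart R l N) x :
  dom c1 (f (icoord c0 x)) ->
  locrep g c1 c2 (locrep f c0 c1 x) = locrep (g \o f) c0 c2 x.
Proof. by move=> dx; rewrite /locrep coordK. Qed.

Lemma jacobian_locrep m n l (L M N : topologicalType) (f : L -> M) (g : M -> N)
    (c0 : chart R m L) (c1 : chart R n M) (c2 : chart R l N) x :
  {in setT, continuous f} ->
  smooth_on (locdom f setT c0 c1) (locrep f c0 c1) ->
  smooth_on (locdom g setT c1 c2) (locrep g c1 c2) ->
  locdom f setT c0 c1 x -> dom c2 (g (f (icoord c0 x))) ->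
  jacobian (locrep (g \o f) c0 c2) x =
  jacobian (locrep f c0 c1) x *m jacobian (locrep g c1 c2) (locrep f c0 c1 x).
Proof.
move=> fc sf sg x01 x2.
have df : differentiable (locrep f c0 c1) x by exact: (sf [::]).
have dg : differentiable (locrep g c1 c2) (locrep f c0 c1 x).
  apply: (sg [::]) => //; case: x01 => _ _ x1; split=> //.
  - exact: mem_img.
  - by rewrite /locrep coordK.
apply: etrans _ (jacobian_comp df dg); apply/esym; apply: near_eq_jacobian.
  apply: filterS (near_dom fc x01) => y [_ _ y1]; exact: locrep_comp.
exact: differentiable_comp.
Qed.

End LocalRepresentatives.

(** As [r] has no repetition, the test [i == l] singles out exactly one factor to differentiate. *)
Lemma is_derive_prod (R : realType) (V : normedModType R) (I : eqType) (r : seq I)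
    (f : I -> V -> R) x u :
  uniq r -> (forall i, derivable (f i) x u) ->
  is_derive x u (\prod_(i <- r) f i)
    (\sum_(l <- r) \prod_(i <- r) (if i == l then 'D_u (f i) x else f i x)).
Proof.
move=> + df; elim: r => [|i0 r IH] /=.
  by rewrite !big_nil => _; exact: is_derive_cst.
move=> /andP[i0r ur]; rewrite !big_cons eqxx.
apply: (is_derive_eq (is_deriveM (derivableP (df i0)) (IH ur))); rewrite addrC; congr (_ + _).
  rewrite [LHS]/GRing.scale /= mulrC; congr (_ * _).
  rewrite fct_prodE [RHS]big_seq [LHS]big_seq; apply: eq_bigr => i ir.
  by case: eqP => // ii0; rewrite -ii0 ir in i0r.
rewrite [LHS]/GRing.scale /= mulr_sumr [RHS]big_seq [LHS]big_seq.
apply: eq_bigr => l lr; rewrite big_cons.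
by case: eqP => // il; rewrite il lr in i0r.
Qed.

Section Pullback.
Variables (R : realType) (n : nat) (N M : manifold R n) (p : N -> M).
Hypothesis sp : smooth_map p.

Let p_cont : {in setT, continuous p}. Proof. by case: sp. Qed.

Let F (c : atlas N) (c' : atlas M) := locrep p c c'.

Let F_smooth (c : atlas N) (c' : atlas M) :
  smooth_on (locdom p setT c c') (F c c').
Proof. by case: sp => _; exact. Qed.

Let dF (c : atlas N) (c' : atlas M) x :
  locdom p setT c c' x -> differentiable (F c c') x.
Proof. by move=> xD; exact: (F_smooth [::]). Qed.

Lemma mulmx_jacobian k (c : atlas N) (c' : atlas M) x (v : 'M[R]_(k, n)) i j :
  locdom p setT c c' x ->
  (v *m jacobian (locrep p c c') x) i j =
  ('D_(row i v) (locrep p c c') x) 0 j.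
Proof.
by move=> xD; rewrite deriveEjacobian -?row_mul ?mxE //; exact: dF.
Qed.

Lemma img_locrep (c : atlas N) (c' : atlas M) x :
  locdom p setT c c' x -> img c' (locrep p c c' x).
Proof. by case=> _ _; exact: mem_img. Qed.

Section Form.
Variables (k : nat) (w : rform M k).
Hypothesis fw : form_spec w.

(** Makes the dependence on [x] explicit, as a finite sum of products of functions that can be
    differentiated separately. *)
Lemma pullback_at_expand (c : atlas N) (c' : atlas M) x v :
  locdom p setT c c' x ->
  pullback_at p w c c' x v = \sum_(h : {ffun 'I_k -> 'I_n})
    (\prod_i (('D_(row i v) (locrep p c c') x) 0 (h i))) *
    w c' (locrep p c c' x) (rowsub h 1%:M).
Proof.
move=> xD; rewrite /pullback_at.
rewrite (multilinear_expand (form_multilinear fw (img_locrep xD))).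
apply: eq_bigr => h _; congr (_ * _).
by apply: eq_bigr => i _; rewrite mulmx_jacobian.
Qed.

Lemma pullback_at_smooth (c : atlas N) (c' : atlas M) v :
  smooth_on (locdom p setT c c') (fun x => pullback_at p w c c' x v).
Proof.
have oD : open (locdom p setT c c') by exact: locdom_open.
pose G (h : {ffun 'I_k -> 'I_n}) : 'rV[R]_n -> R :=
  (\prod_(i <- index_enum 'I_k) (fun x => ('D_(row i v) (locrep p c c') x) 0 (h i))) *
  ((fun y => w c' y (rowsub h 1%:M)) \o locrep p c c').
apply: (@smooth_on_eq _ _ _ _ (\sum_(h <- index_enum {ffun 'I_k -> 'I_n}) G h)) => //.
  move=> x xD; rewrite pullback_at_expand // fct_sumE; apply: eq_bigr => h _.
  by rewrite /G [LHS]/GRing.mul /= fct_prodE.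
apply: smooth_on_sum => // h; apply: smooth_onM => //.
  apply: smooth_on_prod => // i; apply: smooth_on_coord => //.
  exact: smooth_on_derive (F_smooth (c' := c')).
apply: (smooth_on_comp oD (W := img c')) => //; first exact: img_locrep.
exact: form_smooth.
Qed.

(** The chart chosen in [pullback] may jump as [x] moves. Compatibility of [w] allows any fixed
    chart around [p(x)] instead, as differentiation requires. *)
Lemma pullback_chart (c : atlas N) (c' : atlas M) x v :
  locdom p setT c c' x -> pullback p w c x v = pullback_at p w c c' x v.
Proof.
move=> xD; have [cx _ c'x] := xD; rewrite /pullback.
set c0 := chart_at _.
have x0 : locdom p setT c c0 x by split=> //; exact: mem_chart_at.
have y0 : locdom id setT c0 c' (locrep p c c0 x).
  split=> //; first exact: img_locrep.
  by rewrite /locrep coordK //; exact: mem_chart_at.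
rewrite /pullback_at (form_compat fw _ y0) /pullback_at -mulmxA.
rewrite locrep_comp; last exact: mem_chart_at.
by rewrite -jacobian_locrep //; first [exact: F_smooth|exact: transition_smooth].
Qed.

Lemma locdom_chart_at (c : atlas N) x : img c x ->
  locdom p setT c (chart_at (p (icoord c x))) x.
Proof. by move=> cx; split=> //; exact: mem_chart_at. Qed.

Lemma pullback_form : form_spec (pullback p w).
Proof.
split.
- move=> c v; apply: smooth_on_local => x cx.
  exists (locdom p setT c (chart_at (p (icoord c x)))); first exact: locdom_chart_at.
  apply: smooth_on_eq (@pullback_at_smooth _ _ v); first exact: locdom_open.
  by move=> y yD; rewrite -pullback_chart.
- move=> c x cx A B C i b d hA hB hC; rewrite /pullback /pullback_at.
  have xD := img_locrep (locdom_chart_at cx).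
  apply: (form_multilinear fw xD (i := i)).
  + by rewrite !row_mul hA mulmxDl !scalemxAl.
  + by rewrite !row'Esub -!mul_rowsub_mx -!row'Esub hB.
  + by rewrite !row'Esub -!mul_rowsub_mx -!row'Esub hC.
- move=> c x cx A i j ij Aij; rewrite /pullback /pullback_at.
  have xD := img_locrep (locdom_chart_at cx).
  by apply: (form_alternating fw xD ij); rewrite !row_mul Aij.
- move=> c c' x v cc'; have [cx _ c'x] := cc'.
  have cx' : img c' (locrep id c c' x) by exact: mem_img.
  have xE : icoord c' (locrep id c c' x) = icoord c x.
    by rewrite /locrep coordK.
  rewrite [RHS]/pullback_at /pullback xE; set c0 := chart_at _.
  have x0 : locdom p setT c' c0 (locrep id c c' x).
    by split=> //; rewrite xE; exact: mem_chart_at.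
  rewrite /pullback_at -mulmxA locrep_comp // -jacobian_locrep //.
  + by move=> y _ A.
  + exact: transition_smooth.
  + exact: mem_chart_at.
Qed.

(** Product rule on the expansion: the first term differentiates the coefficients of [w], the [l]-th
    summand the Jacobian in the [l]-th argument. *)
Lemma derive_pullback_at (c : atlas N) (c' : atlas M) x u v :
  locdom p setT c c' x ->
  'D_u (fun y => pullback_at p w c c' y v) x =
  'D_(u *m jacobian (locrep p c c') x)
     (fun y => w c' y (v *m jacobian (locrep p c c') x)) (locrep p c c' x) +
  \sum_l w c' (locrep p c c' x)
    (rset l ('D_u ('D_(row l v) (locrep p c c')) x)
       (v *m jacobian (locrep p c c') x)).
Proof.
move=> xD; set J := jacobian _ _.
have oD : open (locdom p setT c c') by exact: locdom_open.
have Fx := img_locrep xD.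
pose a (h : {ffun 'I_k -> 'I_n}) i : 'rV[R]_n -> R :=
  fun x => ('D_(row i v) (locrep p c c') x) 0 (h i).
pose b (h : {ffun 'I_k -> 'I_n}) : 'rV[R]_n -> R :=
  fun y => w c' y (rowsub h 1%:M).
pose G h : 'rV[R]_n -> R := (\prod_(i <- index_enum 'I_k) a h i) *
  (b h \o locrep p c c').
have dDF i : differentiable ('D_(row i v) (locrep p c c')) x.
  exact: (F_smooth [:: _]).
have da h i : derivable (a h i) x u.
  apply: diff_derivable;
  apply: (differentiable_comp (g := fun z : 'rV[R]_n => z 0 (h i)) (dDF i)).
  exact: differentiable_coord.
have daE h i : 'D_u (a h i) x = ('D_u ('D_(row i v) (locrep p c c')) x) 0 (h i).
  by rewrite derive_rV_coord.
have db h : differentiable (b h) (locrep p c c' x).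
  by apply: (@form_smooth _ _ _ _ _ fw c' _ [::]).
have dbF h : derivable (b h \o locrep p c c') x u.
  by apply: diff_derivable; apply: differentiable_comp; [exact: dF|exact: db].
have dbE h : 'D_u (b h \o locrep p c c') x = 'D_(u *m J) (b h) (locrep p c c' x).
  by rewrite derive_comp; [rewrite deriveEjacobian //; exact: dF|exact: dF|].
have dG h : is_derive x u (G h)
    ((\prod_i a h i x) * 'D_(u *m J) (b h) (locrep p c c' x) +
     \sum_l (\prod_i (if i == l then 'D_u (a h i) x else a h i x)) *
        b h (locrep p c c' x)).
  apply: (is_derive_eq (is_deriveM (is_derive_prod (index_enum_uniq _) (da h))
    (derivableP (dbF h)))); rewrite dbE fct_prodE; congr (_ + _).
  by rewrite [LHS]/GRing.scale /= mulrC mulr_suml.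
have [_ D] : is_derive x u (\sum_h G h) (\sum_h
    ((\prod_i a h i x) * 'D_(u *m J) (b h) (locrep p c c' x) +
     \sum_l (\prod_i (if i == l then 'D_u (a h i) x else a h i x)) *
        b h (locrep p c c' x))).
  elim/big_ind2 : _ => // [|f f' g g' df dg]; first exact: is_derive_cst.
  exact: is_deriveD.
transitivity ('D_u (\sum_h G h) x).
  apply: near_eq_derive; apply: filterS (near_dom p_cont xD) => y yD.
  rewrite pullback_at_expand // fct_sumE; apply: eq_bigr => h _.
  by rewrite /G [RHS]/GRing.mul /= fct_prodE.
rewrite D big_split /=; congr (_ + _).
  have [_ D'] : is_derive (locrep p c c' x) (u *m J)
      (\sum_h (fun y => (\prod_i a h i x) * b h y))
      (\sum_h (\prod_i a h i x) * 'D_(u *m J) (b h) (locrep p c c' x)).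
    elim/big_ind2 : _ => // [|f f' g g' df dg|h _]; first exact: is_derive_cst.
      exact: is_deriveD.
    by apply: is_deriveZ; apply: derivableP; exact: diff_derivable.
  rewrite -D'; apply: near_eq_derive.
  apply: filterS (open_nbhs_nbhs (conj (@img_open R n M c') Fx)) => y cy.
  rewrite fct_sumE (multilinear_expand (form_multilinear fw cy)).
  apply: eq_bigr => h _; congr (_ * _).
  by apply: eq_bigr => i _; rewrite mulmx_jacobian.
rewrite exchange_big /=; apply: eq_bigr => l _.
rewrite (multilinear_expand (form_multilinear fw Fx)).
apply: eq_bigr => h _; congr (_ * _); apply: eq_bigr => i _.
rewrite mxE; case: eqP => [->|_]; first by rewrite daE.
by rewrite mulmx_jacobian.
Qed.

Lemma ext_d_pullback (c : atlas N) (c' : atlas M) x v :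
  locdom p setT c c' x ->
  ext_d (pullback p w) c x v =
  ext_d w c' (locrep p c c' x) (v *m jacobian (locrep p c c') x).
Proof.
move=> xD; have [cx _ _] := xD; have Fx := img_locrep xD.
set J := jacobian _ _.
apply: (mulfI (factR_neq0 R k)); apply: etrans (esym (alt_pd v pullback_form cx)) _.
apply: etrans _ (alt_pd (v *m J) fw Fx).
(* The terms of [derive_pullback_at] that contain second derivatives of the map. *)
pose psi l (v : 'M[R]_(k.+1, n)) := w c' (locrep p c c' x)
  (rset l ('D_(row ord0 v) ('D_(row l (row' ord0 v)) (locrep p c c')) x)
     (row' ord0 v *m J)).
rewrite (@eq_alt _ _ _ _ (fun v => pd w c' (locrep p c c' x) (v *m J) +
    \sum_l psi l v)) => [|u]; last first.
  have E : row' ord0 (u *m J) = row' ord0 u *m J by rewrite !row'Esub mul_rowsub_mx.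
  rewrite /pd row_mul E; apply: etrans _ (derive_pullback_at _ _ xD).
  apply: near_eq_derive; apply: filterS (near_dom p_cont xD) => y yD.
  exact: pullback_chart.
rewrite altD alt_sum big1 ?addr0 => [|l _].
  by apply: eq_bigr => s _; rewrite !row_permE mulmxA.
(* Symmetry of second derivatives makes [psi l] invariant under the exchange of
   the arguments [0] and [l + 1], so its alternation vanishes. *)
have psiE u : psi l (row_perm (tperm ord0 (lift ord0 l)) u) = psi l u.
  rewrite /psi.
  have -> : row ord0 (row_perm (tperm ord0 (lift ord0 l)) u) = row l (row' ord0 u).
    by apply/rowP => j; rewrite !mxE tpermL.
  have -> : row l (row' ord0 (row_perm (tperm ord0 (lift ord0 l)) u)) = row ord0 u.
    by apply/rowP => j; rewrite !mxE tpermR.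
  congr (w _ _ _).
  rewrite (derive_rV_comm _ _ (locdom_open (c := c) (c' := c') p_cont)
    (@F_smooth c c') xD).
  apply/matrixP => i j; rewrite !mxE; case: eqP => // /eqP il.
  apply: eq_bigr => z _; rewrite !mxE tpermD //.
  by rewrite (inj_eq lift_inj) eq_sym.
have /eqP : alt (psi l) v = - alt (psi l) v.
  apply: etrans (eq_alt (fun u => esym (psiE u)) v) _.
  by apply: etrans (alt_comp _ _ _) _; rewrite odd_tperm mulN1r.
by rewrite -addr_eq0 -mulr2n mulrn_eq0 => /eqP.
Qed.

Lemma pullback_closed : rform_eq (ext_d w) 0 -> rform_eq (ext_d (pullback p w)) 0.
Proof.
move=> w0 c x v cx; rewrite (ext_d_pullback v (locdom_chart_at cx)) w0 //.
by apply: img_locrep; exact: locdom_chart_at.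
Qed.

End Form.

Lemma pullback_wedge i j (a : rform M i) (b : rform M j) :
  pullback p (wedge a b) = wedge (pullback p a) (pullback p b).
Proof.
apply/funext => c; apply/funext => x; apply/funext => v.
rewrite /pullback /pullback_at /wedge; congr (_ * _).
apply: eq_bigr => s _; congr (_ * _).
by rewrite mul_usub_mx mul_dsub_mx !row_permE mulmxA.
Qed.

End Pullback.

(** * Norm bounds *)

Section CovectorNorm.
Variables (R : realType) (n : nat).

Lemma covector_norm_ge0 k (E : 'M[R]_n) (f : 'M[R]_(k, n) -> R) :
  0 <= covector_norm E f.
Proof. exact: sqrtr_ge0. Qed.

(** The square of one component is at most [k!] times the squared norm; [k!] is then enlarged to its
    square. *)
Lemma component_le_covector_norm k (E : 'M[R]_n) (f : 'M[R]_(k, n) -> R)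
    (h : {ffun 'I_k -> 'I_n}) :
  `|f (rowsub h E)| <= k`!%:R * covector_norm E f.
Proof.
have S0 : 0 <= \sum_(h : {ffun 'I_k -> 'I_n}) f (rowsub h E) ^+ 2.
  by apply: sumr_ge0 => i _; exact: sqr_ge0.
have kR : 1 <= k`!%:R :> R by rewrite ler1n fact_gt0.
rewrite -(@ler_pXn2r R 2) ?nnegrE //; last first.
  by rewrite mulr_ge0 ?covector_norm_ge0 // (le_trans ler01).
rewrite real_normK ?num_real // exprMn sqr_sqrtr; last first.
  by rewrite mulr_ge0 // invr_ge0 (le_trans ler01).
rewrite expr2 -mulrA mulVKf ?factR_neq0 //.
apply: (@le_trans _ _ (\sum_(h : {ffun 'I_k -> 'I_n}) f (rowsub h E) ^+ 2)).
  rewrite (bigD1 h) //= lerDl; apply: sumr_ge0 => i _; exact: sqr_ge0.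
by rewrite ler_peMl.
Qed.

Lemma covector_norm_le k (E : 'M[R]_n) (f : 'M[R]_(k, n) -> R) B :
  0 <= B -> (forall h : {ffun 'I_k -> 'I_n}, `|f (rowsub h E)| <= B) ->
  covector_norm E f <= #|{ffun 'I_k -> 'I_n}|%:R * B.
Proof.
move=> B0 fB; set C := #|_|; have CB : 0 <= C%:R * B by rewrite mulr_ge0.
rewrite -[leRHS]ger0_norm // -sqrtr_sqr ler_wsqrtr //.
apply: (@le_trans _ _ (\sum_(h : {ffun 'I_k -> 'I_n}) B ^+ 2)).
  apply: (@le_trans _ _ (\sum_(h : {ffun 'I_k -> 'I_n}) f (rowsub h E) ^+ 2)).
    rewrite ler_piMl //; first by apply: sumr_ge0 => i _; exact: sqr_ge0.
    by rewrite invf_le1 ?ler1n ?ltr0n fact_gt0.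
  apply: ler_sum => h _; rewrite -[_ ^+ 2]real_normK ?num_real //.
  by rewrite ler_pXn2r ?nnegrE.
rewrite sumr_const -/C exprMn -[leLHS]mulr_natl ler_wpM2r ?sqr_ge0 //.
by rewrite -natrX ler_nat; case: (C) => // m; rewrite expnS leq_pmulr // expn_gt0.
Qed.

(** Each of the [(p + q)!] summands is a component of [a] times one of [b], at most [p! q!] times
    the product of the norms; the normalization cancels [p! q!]. *)
Lemma wedge_component_le (M : manifold R n) p q (a : rform M p) (b : rform M q)
    (c : atlas M) x (E : 'M[R]_n) (h : {ffun 'I_(p + q) -> 'I_n}) :
  `|wedge a b c x (rowsub h E)| <=
  (p + q)`!%:R * (covector_norm E (a c x) * covector_norm E (b c x)).
Proof.
rewrite /wedge normrM ger0_norm ?invr_ge0 // mulrC ler_pdivrMr; last first.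
  by rewrite ltr0n muln_gt0 !fact_gt0.
apply: le_trans (ler_norm_sum _ _ _) _.
set K := covector_norm _ _ * _.
apply: (@le_trans _ _ (\sum_(s : 'S_(p + q)) (p`! * q`!)%:R * K)); last first.
  by rewrite sumr_const card_Sn -[leLHS]mulr_natl [leLHS]mulrCA [leRHS]mulrC.
apply: ler_sum => s _; rewrite normrM normrX normrN normr1 expr1n mul1r normrM.
have -> : usubmx (row_perm s (rowsub h E)) =
    rowsub [ffun i => h (s (lshift q i))] E.
  by apply/matrixP => i j; rewrite !mxE ffunE.
have -> : dsubmx (row_perm s (rowsub h E)) =
    rowsub [ffun i => h (s (rshift p i))] E.
  by apply/matrixP => i j; rewrite !mxE ffunE.
rewrite natrM mulrACA; apply: ler_pM => //; exact: component_le_covector_norm.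
Qed.

Lemma Linf_norm_lty (N : manifold R n) (G : atlas N -> 'rV[R]_n -> 'M[R]_n) k
    (w : rform N k) :
  (Linf_norm G w < +oo)%E <-> exists B : R, forall (c : atlas N) x E,
    img c x -> orthonormal (G c x) E -> covector_norm E (w c x) <= B.
Proof.
split=> [|[B wB]]; last first.
  apply: (@le_lt_trans _ _ B%:E); last exact: ltry.
  by apply: ge_ereal_sup => _ [c [x [E [cx oE ->]]]]; rewrite lee_fin; exact: wB.
rewrite /Linf_norm; set S := [set _ | _] => Soo.
(* The supremum is [-oo] only for empty [S], which the given frame excludes. *)
exists (fine (ereal_sup S)) => c x E cx oE.
have : ((covector_norm E (w c x))%:E <= ereal_sup S)%E.
  by apply: ereal_sup_ubound; exists c, x, E.
by move: Soo; case: (ereal_sup S) => [r||] //=; rewrite lee_fin.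
Qed.

Lemma Linf_norm_wedge (N : manifold R n) (G : atlas N -> 'rV[R]_n -> 'M[R]_n) p q
    (a : rform N p) (b : rform N q) :
  (Linf_norm G a < +oo)%E -> (Linf_norm G b < +oo)%E ->
  (Linf_norm G (wedge a b) < +oo)%E.
Proof.
move=> /Linf_norm_lty[A aA] /Linf_norm_lty[B bB]; apply/Linf_norm_lty.
exists (#|{ffun 'I_(p + q) -> 'I_n}|%:R * ((p + q)`!%:R * (A * B))).
move=> c x E cx oE.
have A0 : 0 <= A by exact: le_trans (covector_norm_ge0 _ _) (aA c x E cx oE).
have B0 : 0 <= B by exact: le_trans (covector_norm_ge0 _ _) (bB c x E cx oE).
apply: covector_norm_le => [|h]; first by rewrite !mulr_ge0.
apply: le_trans (wedge_component_le _ _ _ _ _ _) _; rewrite ler_wpM2l //.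
apply: ler_pM; rewrite ?covector_norm_ge0 //; [exact: aA|exact: bB].
Qed.

(** Frames orthonormal for a pulled-back inner product push forward to orthonormal frames. This
    serves for [p] as well as for changes of chart. *)
Lemma orthonormal_jacobian (G J E : 'M[R]_n) :
  orthonormal (J *m G *m J^T) E -> orthonormal G (E *m J).
Proof. by rewrite /orthonormal trmx_mul !mulmxA. Qed.

Lemma Linf_norm_pullback (N M : manifold R n) (p : N -> M)
    (g : riemannian_metric M) k (w : rform M k) :
  (Linf_norm g w < +oo)%E -> (Linf_norm (pullback_metric p g) (pullback p w) < +oo)%E.
Proof.
move=> /Linf_norm_lty[B wB]; apply/Linf_norm_lty; exists B => c x E cx.
rewrite /pullback_metric; set c' := chart_at _; set J := jacobian _ _.
move=> /orthonormal_jacobian oE.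
have -> : covector_norm E (pullback p w c x) =
    covector_norm (E *m J) (w c' (locrep p c c' x)).
  rewrite /covector_norm; congr (Num.sqrt (_ * _)); apply: eq_bigr => h _.
  by rewrite /pullback /pullback_at -mul_rowsub_mx.
apply: wB => //; exists (p (icoord c x)) => //; exact: mem_chart_at.
Qed.

End CovectorNorm.

(** * Boundedness of forms on a compact manifold *)

Section CompactBound.
Variables (R : realType) (n : nat) (M : manifold R n).

Lemma continuous_sum_at (T : topologicalType) (I : Type) (r : seq I)
    (f : I -> T -> R) x : (forall i, {for x, continuous (f i)}) ->
  {for x, continuous (fun y => \sum_(i <- r) f i y)}.
Proof.
move=> cf; rewrite (_ : (fun _ => _) = \sum_(i <- r) f i); last first.
  by apply/funext => y; rewrite fct_sumE.
elim/big_ind: _ => //; first exact: cst_continuous.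
by move=> f1 f2 c1 c2; exact: continuousD.
Qed.

Lemma continuous_prod_at (T : topologicalType) (I : Type) (r : seq I)
    (f : I -> T -> R) x : (forall i, {for x, continuous (f i)}) ->
  {for x, continuous (fun y => \prod_(i <- r) f i y)}.
Proof.
move=> cf; rewrite (_ : (fun _ => _) = \prod_(i <- r) f i); last first.
  by apply/funext => y; rewrite fct_prodE.
elim/big_ind: _ => //; first exact: cst_continuous.
by move=> f1 f2 c1 c2; exact: continuousM.
Qed.

Lemma continuous_det_at (T : topologicalType) m (A : T -> 'M[R]_m) x :
  (forall i j, {for x, continuous (fun y => A y i j)}) ->
  {for x, continuous (fun y => \det (A y))}.
Proof.
move=> cA; apply: continuous_sum_at => s; apply: continuousM.
  exact: cst_continuous.
by apply: continuous_prod_at => i; exact: cA.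
Qed.

Lemma continuous_adj_at (T : topologicalType) m (A : T -> 'M[R]_m) x i j :
  (forall i j, {for x, continuous (fun y => A y i j)}) ->
  {for x, continuous (fun y => (\adj (A y)) i j)}.
Proof.
move=> cA; rewrite (_ : (fun _ => _) = fun y => cofactor (A y) j i); last first.
  by apply/funext => y; rewrite mxE.
apply: continuousM; first exact: cst_continuous.
apply: continuous_det_at => k l.
rewrite (_ : (fun _ => _) = fun y => A y (lift j k) (lift i l)); first exact: cA.
by apply/funext => y; rewrite !mxE.
Qed.

(* [E G E^T = 1] forces [E^T E = G^-1], so the entries of a frame orthonormal for
   [G] are controlled by the diagonal of [G^-1], which is continuous in [G]. *)
Lemma orthonormal_entry_le m (G E : 'M[R]_m) i j :
  \det G != 0 -> orthonormal G E ->
  `|E i j| <= 1 + (\adj G) j j / \det G.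
Proof.
move=> dG oE.
have EE : E^T *m E *m G = 1%:M by rewrite -mulmxA; exact: mulmx1C.
have adjE : \det G *: (E^T *m E) = \adj G.
  by rewrite -mul_mx_scalar -mul_mx_adj mulmxA EE mul1mx.
have -> : (\adj G) j j / \det G = \sum_l E l j ^+ 2.
  rewrite -adjE mxE mulrC mulKf // mxE; apply: eq_bigr => l _.
  by rewrite mxE expr2.
apply: (@le_trans _ _ (1 + E i j ^+ 2)); last first.
  rewrite lerD2l (bigD1 i) //= lerDl; apply: sumr_ge0 => l _; exact: sqr_ge0.
rewrite -[E i j ^+ 2]real_normK ?num_real //.
have [e1|e1] := leP `|E i j| 1; first by rewrite ler_wpDr // sqr_ge0.
by rewrite ler_wpDl // expr2 ler_peMl // ltW.
Qed.

Lemma metric_det_neq0 (g : riemannian_metric M) (c : atlas M) x :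
  img c x -> \det (g c x) != 0.
Proof.
move=> cx; apply/det0P => -[u u0 ug].
by have := metric_pos g cx u0; rewrite ug mul0mx mxE ltxx.
Qed.

Lemma continuous_at_bound (T : topologicalType) (f : T -> R) x :
  {for x, continuous f} -> \forall y \near x, `|f y| <= `|f x| + 1.
Proof.
move=> /cvgrPdist_le/(_ 1 ltr01); apply: filterS => y fy.
by rewrite -lerBlDl (le_trans (lerB_dist _ _)) // distrC.
Qed.

Lemma covector_norm_locally_bounded (g : riemannian_metric M) k (w : rform M k)
    (c : atlas M) x : form_spec w -> img c x ->
  exists B : R, \forall y \near x, forall E, orthonormal (g c y) E ->
    covector_norm E (w c y) <= B.
Proof.
move=> fw cx.
have cg i j : {for x, continuous (fun y => g c y i j)}.
  apply: differentiable_continuous.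
  apply: (differentiable_comp (f := g c) (g := fun A : 'M[R]_n => A i j)).
    exact: (@metric_smooth _ _ _ g c [::]).
  exact: differentiable_coord.
pose G j y := (\adj (g c y)) j j / \det (g c y).
have cG j : {for x, continuous (G j)}.
  apply: continuousM; first exact: continuous_adj_at.
  by apply: continuousV; [exact: metric_det_neq0|exact: continuous_det_at].
pose b (h : {ffun 'I_k -> 'I_n}) y := w c y (rowsub h 1%:M).
have cb h : {for x, continuous (b h)}.
  by apply: differentiable_continuous; exact: (@form_smooth _ _ _ _ _ fw c _ [::]).
(* Near [x], [K] bounds the entries of all orthonormal frames and [L] the sum of the absolute values
   of the coefficients of [w]. A component of [w] in such a frame is then at most [K^k L]. *)
pose K := 1 + \sum_j (`|G j x| + 1).
pose L := \sum_h (`|b h x| + 1).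
have K0 : 0 <= K by rewrite addr_ge0 // sumr_ge0 // => j _; rewrite addr_ge0.
have L0 : 0 <= L by rewrite sumr_ge0 // => h _; rewrite addr_ge0.
have GK : \forall y \near x, forall j, `|G j y| <= `|G j x| + 1.
  apply: (@filter_forall _ _ (fun j y => `|G j y| <= `|G j x| + 1) (nbhs x) _).
  by move=> j; exact: (continuous_at_bound (cG j)).
have bL : \forall y \near x, forall h, `|b h y| <= `|b h x| + 1.
  apply: (@filter_forall _ _ (fun h y => `|b h y| <= `|b h x| + 1) (nbhs x) _).
  by move=> h; exact: (continuous_at_bound (cb h)).
have nc : \forall y \near x, img c y.
  by apply: open_nbhs_nbhs; split=> //; exact: img_open.
exists (#|{ffun 'I_k -> 'I_n}|%:R * (K ^+ k * L)).
apply: filterS3 GK bL nc => y GK bL cy E oE.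
have EK i j : `|E i j| <= K.
  apply: le_trans (orthonormal_entry_le i j (metric_det_neq0 g cy) oE) _.
  rewrite lerD2l (le_trans (ler_norm _)) // (le_trans (GK j)) //.
  by rewrite (bigD1 j) //= lerDl sumr_ge0 // => l _; rewrite addr_ge0.
apply: covector_norm_le => [|h]; first by rewrite mulr_ge0 // exprn_ge0.
rewrite (multilinear_expand (form_multilinear fw cy)).
apply: le_trans (ler_norm_sum _ _ _) _; rewrite mulr_sumr; apply: ler_sum => h' _.
rewrite normrM; apply: ler_pM => //; last exact: bL.
rewrite normr_prod; apply: (@le_trans _ _ (\prod_(i < k) K)).
  by apply: ler_prod => i _; rewrite normr_ge0 mxE EK.
by rewrite prodr_const card_ord.
Qed.

Lemma Linf_norm_compact (g : riemannian_metric M) k (w : rform M k) :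
  compact [set: M] -> form_spec w -> (Linf_norm g w < +oo)%E.
Proof.
move=> /compact_near_coveringP cM fw; apply/Linf_norm_lty.
pose P (B : R) m := forall (c : atlas M) x E, img c x -> icoord c x = m ->
  orthonormal (g c x) E -> covector_norm E (w c x) <= B.
(* Compactness in the form of near coverings: every point has a neighbourhood on which all large [B]
   are bounds, hence some [B] works everywhere. *)
have : \forall B \near +oo, [set: M] `<=` P B.
  apply: cM => m _; set c0 := chart_at m.
  have c0m : dom c0 m by exact: mem_chart_at.
  have [B0 HB0] := covector_norm_locally_bounded g fw (mem_img c0m).
  have c0c : {for m, continuous c0} by apply: coord_continuous; rewrite inE.
  exists (dom c0 `&` (c0 @^-1` [set y | forall E, orthonormal (g c0 y) E ->
      covector_norm E (w c0 y) <= B0]), [set B | B0 <= B]).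
    split=> /=; last exact: (nbhs_pinfty_ge (num_real B0)).
    apply: filterI; last exact: c0c HB0.
    by apply: open_nbhs_nbhs; split=> //; exact: dom_open.
  move=> [m' B] /= [[c0m' Hm'] B0B] c x E cx xm'.
  (* The local bound is known in the chart [c0] only; compatibility of the metric and of [w]
     transfers it to any chart [c]. *)
  have xD : locdom id setT c c0 x by split=> //=; rewrite xm'.
  rewrite (metric_compat g xD) => /orthonormal_jacobian oE.
  apply: le_trans B0B; move: Hm' oE; rewrite -xm' -/(locrep id c c0 x) => Hm' oE.
  apply: le_trans (Hm' _ oE).
  rewrite /covector_norm le_eqVlt; apply/orP; left; apply/eqP.
  congr (Num.sqrt (_ * _)); apply: eq_bigr => h _.
  by rewrite (form_compat fw _ xD) /pullback_at -mul_rowsub_mx.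
move=> /filter_ex[B HB]; exists B => c x E cx oE.
exact: (HB (icoord c x)).
Qed.

End CompactBound.

(** * Bounded classes and the Lefschetz map *)

Section Main.
Variables (R : realType) (n : nat) (N M : manifold R n) (p : N -> M).

Lemma dtilde_bounded_wedge (g : riemannian_metric M) i j (a : rform M i.+1)
    (b : rform M j) :
  smooth_map p -> compact [set: M] -> dtilde_bounded p g a -> form_spec b ->
  rform_eq (ext_d b) 0 -> dtilde_bounded p g (wedge a b : rform M (i.+1 + j)).
Proof.
move=> sp cM [G [fG aG GB]] fb b0; exists (wedge G (pullback p b)).
have fpb := pullback_form sp fb.
split.
- exact: wedge_form.
- move=> c x v cx.
  have pb0 := pullback_closed sp fb b0.
  have pbb : rform_eq (pullback p b) (pullback p b) by [].
  apply: etrans (congr1 (fun w : rform N (i.+1 + j) => w c x v)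
    (pullback_wedge p a b)) _.
  apply: etrans (rform_eq_wedge aG pbb v cx) _.
  by rewrite ext_d_wedge_closedr.
- apply: Linf_norm_wedge => //; apply: Linf_norm_pullback.
  exact: Linf_norm_compact.
Qed.

Lemma Vdtilde_lefschetz (g : riemannian_metric M) (a : deRham M 2) r i q
    (e : (r.*2 + i = q)%N) (b : deRham M i) :
  smooth_map p -> compact [set: M] -> (1 <= r)%N -> Vdtilde p g r.*2 (cup_pow a r) ->
  Vdtilde p g q (lefschetz a e b).
Proof.
(* As [r] is positive, [r.*2] is a successor, so boundedness provides a primitive. *)
case: r e => // r; case: q / => sp cM _; rewrite /lefschetz /=.
elim/deRham_ind: b => b [w /= wB <-].
have [fb b0] := closed_formP b.
exists (cwedge w b); last by rewrite cup_class.
exact: (@dtilde_bounded_wedge g r.*2.+1 i).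
Qed.

End Main.

Theorem proposition7p1 (R : realType) (n : nat)
    (M Mt : manifold R n.*2) (p : Mt -> M) (g : riemannian_metric M)
    (a : deRham M 2) (r : nat)
    (M_compact : compact [set: M])
    (p_cover : universal_cover p)
    (r_ge1 : (1 <= r)%N)
    (ar_bounded : cup_pow a r \in Vdtilde p g r.*2) :
  (forall (q : nat) (rq : (r.*2 <= q)%N), (q <= n.*2)%N ->
     (forall c : deRham M q, exists b : deRham M (q - r.*2),
        lefschetz a (subnKC rq) b = c) ->
     Vdtilde p g q = [set: deRham M q])
  /\
  ((exists2 w : closed_form M 2, symplectic w & class_of w = a) ->
   hard_lefschetz a ->
   forall (q : nat) (rq : (r.*2 <= q)%N), (q <= n.*2)%N -> (n + r <= q)%N ->
     forall c : deRham M q, exists b : deRham M (q - r.*2),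
       lefschetz a (subnKC rq) b = c).
Proof.
case: p_cover => -[sp _ _] _.
split=> [q rq _ surj|_ hl q rq qn nrq]; last exact: hard_lefschetz_surjective.
rewrite -subTset => c _; have [b <-] := surj c.
by apply: Vdtilde_lefschetz => //; rewrite -inE.
Qed.
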